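(* Set $I=[-1/2,1/2]\subseteq\mathbb{C}$. There exists a Swiss cheese $X\subseteq\mathbb{C}$ with $I\subseteq X$ such that every point of $X\setminus I$ is a point of continuity for $R(X)$, but such that for every $f\in R(X)$ the restriction of $f$ to $I$ is infinitely differentiable and satisfies $$\sum_{k=1}^{\infty}\frac{1}{|f^{(k)}|_I^{1/k}}=\infty .$$
   Context: A Swiss cheese is a compact plane set $X$ of the form $X=\bar\Delta\setminus\bigcup_{n=1}^\infty D_n$, where $\bar\Delta=\{z\in\mathbb{C}:|z|\le 1\}$ and $(D_n)$ is a sequence of open discs in $\mathbb{C}$ (not necessarily pairwise disjoint) whose radii have finite sum. For a compact set $X\subseteq\mathbb{C}$, $R_0(X)$ is the set of restrictions to $X$ of rational functions with poles off $X$, and $R(X)$ is the closure of $R_0(X)$ in $C(X)$ (the continuous complex-valued functions on $X$) for the uniform norm. It is a uniform algebra on $X$. Let $A$ be a uniform algebra on a compact space $X$. For $x\in X$, let $M_x$ be the ideal of functions in $A$ vanishing at $x$, and $J_x$ the ideal of functions in $A$ vanishing in a neighbourhood of $x$ (in $X$). A point $x\in X$ is a point of continuity for $A$ if there is no $y\in X\setminus\{x\}$ with $M_x\supseteq J_y$. For a bounded complex-valued function $g$ on a non-empty set $S$, $|g|_S=\sup\{|g(x)|:x\in S\}$. Here $f^{(k)}$ denotes the $k$-th derivative of the restriction of $f$ to the real interval $I$ (one-sided at the endpoints), and $1/0$ is interpreted as $+\infty$ in the sum. *)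

(* Defs.v *)
From HB Require Import structures.
From mathcomp Require Import all_boot all_order all_algebra.
From mathcomp Require Import complex.
From mathcomp Require Import all_classical all_reals all_analysis.
Set Implicit Arguments.
Unset Strict Implicit.
Unset Printing Implicit Defensive.
Import Order.TTheory GRing.Theory Num.Theory numFieldNormedType.Exports.
Local Open Scope classical_set_scope.
Local Open Scope ring_scope.
Local Open Scope complex_scope.

(* The standard topology of the numFieldType R[i], made canonical on R[i]. *)
HB.instance Definition _ (R : rcfType) := NormedModule.copy R[i] R[i]^o.

Section FunctionAlgebras.
Context {T : topologicalType} {K : zmodType}.
Implicit Types (X : set T) (A : set (T -> K)).

(* An algebra of functions on X is represented by a set A of total functions
   T -> K, of which only the values on X matter. *)
Definition vanishing_ideal A (x : T) : set (T -> K) :=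
  [set f | A f /\ f x = 0].

Definition local_vanishing_ideal X A (x : T) : set (T -> K) :=
  [set f | A f /\ \forall z \near within X (nbhs x), f z = 0].

Definition continuity_point X A (x : T) : Prop :=
  X x /\ ~ exists y, [/\ X y, y != x &
    local_vanishing_ideal X A y `<=` vanishing_ideal A x].

End FunctionAlgebras.

Section PlaneSets.
Context {R : realType}.
Implicit Types (X S : set R[i]) (f g : R[i] -> R[i]).

Definition swiss_cheese X : Prop :=
  compact X /\
  exists (c : nat -> R[i]) (r : nat -> R),
    [/\ forall n, 0 < r n,
        cvgn (series r) &
        X = [set z | `|z| <= 1] `\` \bigcup_n ball (c n) (r n)%:C].

Definition rational_on X : set (R[i] -> R[i]) :=
  [set f | exists p q : {poly R[i]},
    forall z, X z -> q.[z] != 0 /\ f z = p.[z] / q.[z]].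

(* R(X); membership depends only on the restriction to X. *)
Definition rational_algebra X : set (R[i] -> R[i]) :=
  [set f | {within X, continuous f} /\
    closure (rational_on X : set {uniform` X -> R[i]}) f].

Definition half_segment : set R[i] :=
  [set x%:C | x in `[- 2^-1, 2^-1]%classic].

(* Differentiation along S: the increments are restricted to S, so that on a
   segment of the real line this is the derivative of the restriction to the
   segment, one-sided at the endpoints. *)
Definition difference_quotients S f (x : R[i]) : set_system R[i] :=
  (f w - f x) / (w - x) @[w --> within S x^'].

Definition derive_within S f : R[i] -> R[i] :=
  fun x => lim (difference_quotients S f x).

Definition nderive_within S (k : nat) f : R[i] -> R[i] :=
  iter k (derive_within S) f.

Definition smooth_within S f : Prop :=
  forall k x, S x -> cvg (difference_quotients S (nderive_within S k f) x).

(* The norm of R[i] takes its values in R[i], whence the real part. *)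
Definition sup_norm S g : \bar R :=
  ereal_sup [set (complex.Re `|g z|)%:E | z in S].

End PlaneSets.

(* Main.v *)
(* Cover the complement of I by countably many discs Delta_m that stay at a
   positive distance from I.  By McKissick's lemma one may delete from Delta_m
   countably many small discs, of total radius at most eps_m, so that some uniform
   limit of rational functions vanishes off Delta_m but not on the concentric disc
   of half the radius: every point off I becomes a point of continuity.  The deleted
   discs of the m-th family lie at a distance at least d_m from I, and Cauchy's
   formula bounds |f^(k)|_I / k! by |f|_X times 4^(k+1) plus the sum over the deleted
   discs D of radius(D) (2 / d_m)^(k+1).  Choosing eps_m small in terms of d_m makes
   the latter sum at most L_k^k with L_k of order log k, and the sum of 1 / (k L_k)
   diverges.

   Cauchy's formula is only needed for rational functions, with uniform bounds; it is
   obtained from means over the vertices of regular N-gons, which are computed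
   algebraically and converge as N grows.  Finitely many of the deleted discs cover
   the poles and the points where f is large; overlapping ones are merged into a
   disc whose radius is the sum of the radii, until the discs are disjoint.  The
   estimate for the second order Taylor remainder on I involves only |f|_X, hence
   passes to uniform limits. *)

Require Import Defs.
From mathcomp Require Import all_boot all_order all_algebra.
From mathcomp Require Import complex.
From mathcomp Require Import all_classical all_reals all_analysis.
From mathcomp Require Import cyclic separable cyclotomic ring lra zify.
Import Order.TTheory GRing.Theory Num.Theory numFieldNormedType.Exports.
Set Implicit Arguments.
Unset Strict Implicit.
Unset Printing Implicit Defensive.
Local Open Scope classical_set_scope.
Local Open Scope ring_scope.
Local Open Scope complex_scope.

(** * Modulus, limits and roots of unity in R[i] *)

(** The discs Delta_m approach I, so no single geometric rate bounds the Taylor coefficients on I: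
    every rate 2 / d_m occurs. A weight L_k is wanted that tends to infinity, so that L_k^k
    eventually beats each A^k while the finitely many remaining k are paid for by a small eps_m, yet
    so slowly that the sum of 1 / (k L_k) diverges. The integer part of 1 + log2 k does both.

    X offers no contour of its own: deleted discs may overlap, accumulate and cross the unit circle.
    The cycle is therefore chosen afresh for each quotient p / q, and its circles may run through
    deleted discs; only |p| <= B |q| has to hold on them. Before limits of quotients can be taken,
    the bounds must be made independent of the cycle and the Taylor coefficients must be shown not
    to depend on it. Each merged disc remembers the discs that it swallowed, so that its
    contribution can be charged back to them one by one. *)

Section Norm.
Context {R : realType}.
Implicit Types (z w : R[i]).

Definition cnorm z : R := complex.Re `|z|.

Lemma cnormE z : `|z| = (cnorm z)%:C.
Proof. by rewrite /cnorm RRe_real // normr_real. Qed.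

Lemma real_complex_inj : injective (fun x : R => x%:C).
Proof. by move=> x y []. Qed.

Lemma cnorm_ge0 z : 0 <= cnorm z.
Proof. by rewrite -lecR -cnormE normr_ge0. Qed.

Lemma cnorm0 : cnorm 0 = 0.
Proof. by rewrite /cnorm normr0. Qed.

Lemma cnorm1 : cnorm 1 = 1.
Proof. by rewrite /cnorm normr1. Qed.

Lemma cnorm_eq0 z : (cnorm z == 0) = (z == 0).
Proof. by rewrite -(inj_eq real_complex_inj) -cnormE normr_eq0. Qed.

Lemma cnorm_gt0 z : (0 < cnorm z) = (z != 0).
Proof. by rewrite lt_def cnorm_ge0 andbT cnorm_eq0. Qed.

Lemma cnormN z : cnorm (- z) = cnorm z.
Proof. by rewrite /cnorm normrN. Qed.

Lemma cnorm_dist z w : cnorm (z - w) = cnorm (w - z).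
Proof. by rewrite -opprB cnormN. Qed.

Lemma cnormM z w : cnorm (z * w) = cnorm z * cnorm w.
Proof. by apply: real_complex_inj; rewrite rmorphM /= -!cnormE normrM. Qed.

Lemma cnormV z : cnorm z^-1 = (cnorm z)^-1.
Proof. by apply: real_complex_inj; rewrite fmorphV /= -!cnormE normfV. Qed.

Lemma cnorm_div z w : cnorm (z / w) = cnorm z / cnorm w.
Proof. by rewrite cnormM cnormV. Qed.

Lemma cnormX z n : cnorm (z ^+ n) = cnorm z ^+ n.
Proof. by apply: real_complex_inj; rewrite rmorphXn /= -!cnormE normrX. Qed.

Lemma cnorm_real (x : R) : cnorm x%:C = `|x|.
Proof. by rewrite /cnorm normc_def /= expr0n /= addr0 sqrtr_sqr. Qed.

Lemma cnorm_realp (x : R) : 0 <= x -> cnorm x%:C = x.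
Proof. by move=> x0; rewrite cnorm_real ger0_norm. Qed.

Lemma cnorm_nat n : cnorm n%:R = n%:R.
Proof. by rewrite -(rmorph_nat (real_complex R)) cnorm_realp. Qed.

Lemma cnormD z w : cnorm (z + w) <= cnorm z + cnorm w.
Proof. by rewrite -lecR rmorphD /= -!cnormE ler_normD. Qed.

Lemma cnormB z w : cnorm (z - w) <= cnorm z + cnorm w.
Proof. by rewrite -(cnormN w) cnormD. Qed.

Lemma cnorm_tri z w u : cnorm (z - w) <= cnorm (z - u) + cnorm (u - w).
Proof. by rewrite -[z - w](subrKA u) cnormD. Qed.

Lemma cnorm_subl z w : cnorm z - cnorm w <= cnorm (z - w).
Proof. by rewrite lerBlDr -{1}(subrK w z) cnormD. Qed.

Lemma cnorm_sum (I : Type) (s : seq I) (P : pred I) (F : I -> R[i]) :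
  cnorm (\sum_(i <- s | P i) F i) <= \sum_(i <- s | P i) cnorm (F i).
Proof.
elim/big_rec2: _ => [|i y x _ h]; first by rewrite cnorm0.
by apply: (le_trans (cnormD _ _)); rewrite lerD2l.
Qed.

Lemma cnorm_prod (I : Type) (s : seq I) (P : pred I) (F : I -> R[i]) :
  cnorm (\prod_(i <- s | P i) F i) = \prod_(i <- s | P i) cnorm (F i).
Proof. by elim/big_rec2: _ => [|i y x _ h]; rewrite ?cnorm1// cnormM h. Qed.

Lemma cnorm_Re z : `|complex.Re z| <= cnorm z.
Proof. by rewrite -lecR -cnormE normc_ge_Re. Qed.

Lemma cnorm_Im z : `|complex.Im z| <= cnorm z.
Proof.
case: z => a b; rewrite /cnorm normc_def /= -sqrtr_sqr.
by rewrite ler_sqrt ?addr_ge0 ?sqr_ge0// lerDr sqr_ge0.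
Qed.

Lemma cnorm_le_ReIm z : cnorm z <= `|complex.Re z| + `|complex.Im z|.
Proof.
rewrite {1}[z]complexE; apply: (le_trans (cnormD _ _)).
rewrite cnormM !cnorm_real [X in X * _](_ : _ = 1) ?mul1r//.
by rewrite /cnorm normc_def /= expr0n /= add0r expr1n sqrtr1.
Qed.

Lemma ball_cnorm z w (e : R) : ball z e%:C w <-> cnorm (z - w) < e.
Proof. by rewrite -ball_normE /ball_ /= cnormE ltcR. Qed.

Lemma gt0_complex (e : R[i]) : 0 < e -> exists2 d : R, 0 < d & e = d%:C.
Proof.
move=> e0; exists (complex.Re e); last by rewrite RRe_real// gtr0_real.
by rewrite -ltcR RRe_real// gtr0_real.
Qed.

Lemma nbhs_cnormP z (A : set R[i]) :
  nbhs z A <-> exists2 d : R, 0 < d & forall w, cnorm (z - w) < d -> A w.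
Proof.
split.
  move=> /nbhs_ballP[e /= /gt0_complex[d d0 ->]] h; exists d => // w zw.
  by apply: h; apply/ball_cnorm.
move=> [d d0 h]; apply/nbhs_ballP; exists d%:C; first by rewrite /= ltcR.
by move=> w /ball_cnorm; apply: h.
Qed.

Lemma cvg_cnormP (T : Type) (F : set_system T) {FF : Filter F} (f : T -> R[i]) z :
  f @ F --> z <-> forall e : R, 0 < e -> \forall x \near F, cnorm (z - f x) < e.
Proof.
split=> [h e e0|h].
  by apply: (h [set w | cnorm (z - w) < e]); apply/nbhs_cnormP; exists e.
by move=> A /nbhs_cnormP[d d0 dA]; apply: filterS (h _ d0) => x; apply: dA.
Qed.

(** Convergence goes through the real-valued modulus, so that real limit theorems and [lra]
    apply. *)
Definition clim (u : nat -> R[i]) v := cnorm (u n - v) @[n --> \oo] --> (0 : R).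

Lemma clim_le (u : nat -> R[i]) v (g : nat -> R) :
  (forall n, cnorm (u n - v) <= g n) -> g @ \oo --> (0 : R) -> clim u v.
Proof.
move=> ug g0; apply: (@squeeze_cvgr _ _ _ _ (fun=> 0) g) => //; last exact: cvg_cst.
by apply: nearW => n; rewrite cnorm_ge0 ug.
Qed.

Lemma climP (u : nat -> R[i]) v :
  clim u v <-> forall e, 0 < e -> \forall n \near \oo, cnorm (u n - v) < e.
Proof.
split=> [/cvgr0Pnorm_lt h e /h|h].
  by apply: filterS => n; rewrite ger0_norm// cnorm_ge0.
apply/cvgr0Pnorm_lt => e /h.
by apply: filterS => n; rewrite ger0_norm// cnorm_ge0.
Qed.

Lemma clim_cst v : clim (fun=> v) v.
Proof. by apply/climP => e e0; apply: nearW => n; rewrite subrr cnorm0. Qed.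

Lemma climD (u1 u2 : nat -> R[i]) v1 v2 :
  clim u1 v1 -> clim u2 v2 -> clim (fun n => u1 n + u2 n) (v1 + v2).
Proof.
move=> h1 h2.
apply: (@clim_le _ _ (fun n => cnorm (u1 n - v1) + cnorm (u2 n - v2))).
  by move=> n; rewrite opprD addrACA cnormD.
by rewrite -[0]addr0; apply: cvgD.
Qed.

Lemma climZ (u : nat -> R[i]) v a : clim u v -> clim (fun n => a * u n) (a * v).
Proof.
move=> h; apply: (@clim_le _ _ (fun n => cnorm a * cnorm (u n - v))).
  by move=> n; rewrite -mulrBr cnormM.
by rewrite -[0](mulr0 (cnorm a)); apply: cvgM => //; apply: cvg_cst.
Qed.

Lemma clim_sum (I : eqType) (s : seq I) (u : I -> nat -> R[i]) (v : I -> R[i]) :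
  (forall i, i \in s -> clim (u i) (v i)) ->
  clim (fun n => \sum_(i <- s) u i n) (\sum_(i <- s) v i).
Proof.
elim: s => [_|i s IH h].
  by under eq_fun do rewrite big_nil; rewrite big_nil; apply: clim_cst.
under eq_fun do rewrite big_cons; rewrite big_cons; apply: climD.
  by apply: h; rewrite mem_head.
by apply: IH => k ks; apply: h; rewrite inE ks orbT.
Qed.

(** Lets a repeated pole be replaced by two distinct ones, at an error that is uniform in [n]. *)
Lemma clim_approx (u : nat -> R[i]) v :
  (forall e, 0 < e -> exists2 u', forall n, cnorm (u n - u' n) <= e & clim u' v) ->
  clim u v.
Proof.
move=> h; apply/climP => e e0; have e20 : 0 < e / 2 by rewrite divr_gt0.
have [u' uu' /climP/(_ _ e20)] := h _ e20; apply: filterS => n u'v.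
by rewrite [e]splitr (le_lt_trans (cnorm_tri _ _ (u' n)))// ler_ltD.
Qed.

Lemma clim_cnorm_le (u : nat -> R[i]) v (B : R) :
  clim u v -> (forall n, cnorm (u n) <= B) -> cnorm v <= B.
Proof.
move=> /climP h uB; apply/ler_addgt0Pr => e /h/filter_ex[n un].
rewrite -(subrK (u n) v) addrC (le_trans (cnormD _ _))// lerD// cnorm_dist ltW//.
Qed.

Lemma clim_unique (u : nat -> R[i]) v w : clim u v -> clim u w -> v = w.
Proof.
move=> uv uw; apply/eqP; rewrite -subr_eq0 -cnorm_eq0 eq_le cnorm_ge0 andbT.
apply: (@clim_cnorm_le (fun n => u n + -1 * u n)).
  by rewrite -[- w]mulN1r; apply: climD => //; apply: climZ.
by move=> n; rewrite mulN1r subrr cnorm0.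
Qed.

End Norm.

Section RootsOfUnity.
Context {R : realType}.

(** X^n - 1 splits over the algebraically closed field [R[i]] and is separable in characteristic 0;
    a group of n distinct n-th roots of unity is cyclic. *)
Lemma prim_root_exists n : (0 < n)%N -> exists w : R[i], n.-primitive_root w.
Proof.
move=> n0; pose p : {poly R[i]} := 'X^n - 1.
have [r Dp] := closed_field_poly_normal p.
move: Dp; rewrite (monicP _) ?monicXnsubC // scale1r => Dp.
have rn1 : all n.-unity_root r by apply/allP => z; rewrite -root_prod_XsubC -Dp.
have sz_r : (n < (size r).+1)%N.
  by rewrite -(size_prod_XsubC r id) -Dp size_XnsubC.
have [|z] := hasP (has_prim_root n0 rn1 _ sz_r); last by exists z.
rewrite -separable_prod_XsubC -Dp separable_Xn_sub_1 //.
by rewrite pnatr_eq0 -lt0n.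
Qed.

(** The index is shifted: [omega n] has order [n.+1], hence makes sense for every [n]. *)
Definition omega n : R[i] := projT1 (cid (prim_root_exists (ltn0Sn n))).

Lemma omegaP n : n.+1.-primitive_root (omega n).
Proof. by rewrite /omega; case: cid. Qed.

Lemma cnorm_omega n i : cnorm (omega n ^+ i) = 1.
Proof.
rewrite cnormX; have : cnorm (omega n) ^+ n.+1 = 1.
  by rewrite -cnormX (prim_expr_order (omegaP n)) cnorm1.
move/eqP; rewrite pexpr_eq1 ?cnorm_ge0// => /eqP ->.
by rewrite expr1n.
Qed.

Lemma sum_omega n l : ~~ (n.+1 %| l)%N ->
  \sum_(i < n.+1) omega n ^+ (i * l) = 0.
Proof.
move=> nl; have : (omega n ^+ l) ^+ n.+1 - 1 = 0.
  by rewrite exprAC (prim_expr_order (omegaP n)) expr1n subrr.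
rewrite -[X in _ - X](expr1n _ n.+1) subrXX => /eqP; rewrite mulf_eq0.
rewrite subr_eq0 -(prim_order_dvd (omegaP n)) (negPf nl) /= => /eqP h.
rewrite (reindex_inj rev_ord_inj) /= -[RHS]h; apply: eq_bigr => i _.
by rewrite expr1n mulr1 -exprM mulnC.
Qed.

(** Logarithmic derivative of w^N - 1 with N = [n.+1]. Each 1 / (w - omega^i) is a geometric sum
    divided by w^N - 1, and summing over [i] leaves only the term free of omega. *)
Lemma sum_inv_omega n (w : R[i]) : w ^+ n.+1 != 1 ->
  \sum_(i < n.+1) (w - omega n ^+ i)^-1 = n.+1%:R * w ^+ n / (w ^+ n.+1 - 1).
Proof.
move=> w1; have w10 : w ^+ n.+1 - 1 != 0 by rewrite subr_eq0.
have E (i : 'I_n.+1) : (w - omega n ^+ i)^-1 =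
    (\sum_(l < n.+1) w ^+ (n - l) * omega n ^+ (i * l)) / (w ^+ n.+1 - 1).
  have h : w ^+ n.+1 - 1 = (w - omega n ^+ i) *
      \sum_(l < n.+1) w ^+ (n - l) * omega n ^+ (i * l).
    rewrite -[X in _ - X](expr1n _ i) -(prim_expr_order (omegaP n)) exprAC subrXX.
    by congr (_ * _); apply: eq_bigr => l _; rewrite -exprM.
  move: w10; rewrite h mulf_eq0 negb_or => /andP[a b].
  by rewrite invfM mulrCA mulfV// mulr1.
under eq_bigr do rewrite E.
rewrite -mulr_suml exchange_big /= big_ord_recl /= [X in _ + X]big1 => [|l _].
  rewrite addr0; congr (_ / _); under eq_bigr do rewrite muln0 expr0 mulr1 ?subn0.
  by rewrite sumr_const card_ord mulr_natl.
rewrite -mulr_sumr sum_omega ?mulr0//.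
by rewrite /dvdn modn_small //= /bump /= add1n ltnS.
Qed.

End RootsOfUnity.

(** * Discrete means over circles and the Cauchy formula for rational functions *)

Section CircleMeans.
Context {R : realType}.
(* A circle is a triple (weight, centre, radius). *)
Local Notation circle := (R[i] * R[i] * R)%type.
Definition weight (x : circle) : R[i] := x.1.1.
Definition centre (x : circle) : R[i] := x.1.2.
Definition radius (x : circle) : R := x.2.

Definition on_circle (x : circle) (w : R[i]) := cnorm (w - centre x) = radius x.

(** Discretisation with [n.+1] nodes of the contour integral of g / (2 pi i), times the weight: on
    the circle, dw / (2 pi i) is r e^(i theta) dtheta / (2 pi). Weights 1 and -1 will encode
    orientation. *)
Definition cmean n (x : circle) (g : R[i] -> R[i]) : R[i] :=
  weight x * ((\sum_(i < n.+1) (radius x)%:C * omega n ^+ i *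
     g (centre x + (radius x)%:C * omega n ^+ i)) / n.+1%:R).

Definition lam n (cs : seq circle) (g : R[i] -> R[i]) : R[i] :=
  \sum_(x <- cs) cmean n x g.

Implicit Types (cs : seq circle) (g h : R[i] -> R[i]).

Lemma on_node (x : circle) n i : 0 <= radius x ->
  on_circle x (centre x + (radius x)%:C * omega n ^+ i).
Proof.
by move=> x0; rewrite /on_circle addrC addKr cnormM cnorm_omega cnorm_realp// mulr1.
Qed.

Definition nonneg_radii cs := forall x, x \in cs -> 0 <= radius x.

Lemma eq_lam n cs g h : nonneg_radii cs ->
  (forall x w, x \in cs -> on_circle x w -> g w = h w) -> lam n cs g = lam n cs h.
Proof.
move=> cs0 gh; rewrite /lam !big_seq; apply: eq_bigr => x xcs.
rewrite /cmean; congr (_ * (_ / _)); apply: eq_bigr => i _.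
by rewrite (gh x)//; apply: on_node; apply: cs0.
Qed.

Lemma lamD n cs g h : lam n cs (fun w => g w + h w) = lam n cs g + lam n cs h.
Proof.
rewrite /lam -big_split; apply: eq_bigr => x _; rewrite /cmean /= -mulrDr -mulrDl.
by congr (_ * (_ / _)); rewrite -big_split; apply: eq_bigr => i _; rewrite mulrDr.
Qed.

Lemma lamZ n cs a g : lam n cs (fun w => a * g w) = a * lam n cs g.
Proof.
rewrite /lam mulr_sumr; apply: eq_bigr => x _; rewrite /cmean [RHS]mulrCA.
congr (_ * _); rewrite mulrA mulr_sumr; congr (_ / _).
by apply: eq_bigr => i _; rewrite mulrCA.
Qed.

Lemma lam_bound n cs g (b : circle -> R) : nonneg_radii cs ->
  (forall x, x \in cs -> cnorm (weight x) <= 1) ->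
  (forall x w, x \in cs -> on_circle x w -> cnorm (g w) <= b x) ->
  cnorm (lam n cs g) <= \sum_(x <- cs) radius x * b x.
Proof.
move=> cs0 cs1 gb; rewrite /lam; apply: (le_trans (cnorm_sum _ _ _)).
rewrite big_seq [X in _ <= X]big_seq; apply: ler_sum => x xcs.
rewrite /cmean cnormM cnorm_div cnorm_nat.
rewrite -[X in _ <= X]mul1r ler_pM ?cnorm_ge0 ?divr_ge0 ?cnorm_ge0 ?cs1//.
rewrite ler_pdivrMr ?ltr0n// mulrC; apply: (le_trans (cnorm_sum _ _ _)).
rewrite -[n.+1 in X in _ <= X]card_ord mulr_natl -sumr_const; apply: ler_sum => i _.
have r0 := cs0 _ xcs.
rewrite !cnormM cnorm_omega cnorm_realp// mulr1 ler_wpM2l// (gb x)//.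
exact: on_node.
Qed.

Lemma clim_expn_cnorm (t : R[i]) : cnorm t < 1 ->
  clim (fun n => (1 - t ^+ n.+1)^-1) 1.
Proof.
move=> t1; have t1' : 0 < 1 - cnorm t by rewrite subr_gt0.
apply: (@clim_le _ _ _ (fun n => cnorm t ^+ n.+1 * (1 - cnorm t)^-1)) => [n|].
  have le1 : 1 - cnorm t <= cnorm (1 - t ^+ n.+1).
    rewrite (le_trans _ (cnorm_subl _ _))// cnorm1 lerB// cnormX.
    by rewrite exprS ler_piMr ?cnorm_ge0// exprn_ile1 ?cnorm_ge0 ?ltW.
  have h1 : 1 - t ^+ n.+1 != 0 by rewrite -cnorm_gt0 (lt_le_trans t1').
  have -> : (1 - t ^+ n.+1)^-1 - 1 = t ^+ n.+1 / (1 - t ^+ n.+1) by field.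
  rewrite cnorm_div -cnormX ler_wpM2l ?cnorm_ge0// lef_pV2// posrE//.
  exact: lt_le_trans le1.
rewrite -[0 in X in _ --> X](mul0r (1 - cnorm t)^-1); apply: cvgM; last exact: cvg_cst.
have /cvg_expr : `|cnorm t| < 1 by rewrite ger0_norm// cnorm_ge0.
by rewrite -(cvg_shiftS (fun n => cnorm t ^+ n)).
Qed.

(** With N nodes and t = (a - centre) / radius, the mean is exactly weight / (1 - t^N), which tends
    to the weight if |t| < 1 and to 0 if |t| > 1. *)
Lemma cmean_pole (x : circle) a : 0 < radius x -> cnorm (a - centre x) != radius x ->
  clim (fun n => cmean n x (fun w => (w - a)^-1))
    (weight x * (cnorm (a - centre x) < radius x)%R%:R).
Proof.
move=> r0 ar; pose t := (a - centre x) / (radius x)%:C.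
have rC0 : (radius x)%:C != 0 :> R[i] by rewrite -cnorm_eq0 cnorm_realp ?gt_eqF ?ltW.
have tE : cnorm t = cnorm (a - centre x) / radius x by rewrite cnorm_div cnorm_realp// ltW.
have t1 n : t ^+ n.+1 != 1.
  apply/eqP => /(congr1 cnorm); rewrite cnormX cnorm1 => /eqP.
  rewrite pexpr_eq1 ?cnorm_ge0// tE => /eqP h; move/eqP: ar; apply.
  by rewrite -[LHS](divfK (lt0r_neq0 r0)) h mul1r.
have E n : cmean n x (fun w => (w - a)^-1) = weight x * (1 - t ^+ n.+1)^-1.
  rewrite /cmean; congr (_ * _).
  have -> : \sum_(i < n.+1) (radius x)%:C * omega n ^+ i *
      (centre x + (radius x)%:C * omega n ^+ i - a)^-1 =
      \sum_(i < n.+1) (1 - t * (t - omega n ^+ i)^-1).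
    apply: eq_bigr => i _.
    have : t - omega n ^+ i != 0.
      apply/eqP => /subr0_eq h; move/eqP: (t1 n); apply.
      by rewrite h exprAC (prim_expr_order (omegaP n)) expr1n.
    rewrite /t => h0; have h1 : centre x + (radius x)%:C * omega n ^+ i - a != 0.
      apply: contraNneq h0 => h1.
      have -> : a = centre x + (radius x)%:C * omega n ^+ i by apply/esym/subr0_eq.
      by apply/eqP; field.
    field; rewrite rC0 h1 /=.
    rewrite andbT; apply: contraNneq h0 => h2; apply/eqP.
    by rewrite -[omega n ^+ i](mulfK rC0) -mulrBl -mulNr h2 mul0r.
  rewrite sumrB sumr_const card_ord -mulr_sumr sum_inv_omega//.
  have N0 : n.+1%:R != 0 :> R[i] by rewrite pnatr_eq0.
  have h1 : 1 - t ^+ n.+1 != 0 by rewrite subr_eq0 eq_sym.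
  have h2 : t ^+ n.+1 - 1 != 0 by rewrite subr_eq0.
  move: N0 h1 h2; rewrite exprS; move: (n.+1%:R : R[i]) (t ^+ n) => N T N0 h1 h2.
  by field; rewrite N0 h1.
under eq_fun do rewrite E.
apply: climZ; case: ltP => [h|h].
  by apply: clim_expn_cnorm; rewrite tE ltr_pdivrMr// mul1r.
have t_gt1 : 1 < cnorm t.
  by rewrite tE ltr_pdivlMr// mul1r lt_neqAle eq_sym ar.
have t0 : t != 0 by rewrite -cnorm_gt0; apply: lt_trans t_gt1.
have /clim_expn_cnorm uc : cnorm t^-1 < 1 by rewrite cnormV invf_lt1// cnorm_gt0.
(* For |t| > 1, the identity 1 / (1 - t^N) = 1 - 1 / (1 - t^(-N)) reduces to a ratio of modulus less
   than 1. *)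
have -> : (fun n => (1 - t ^+ n.+1)^-1) =
    (fun n => 1 + -1 * (1 - t^-1 ^+ n.+1)^-1).
  apply/funext => n; rewrite exprVn.
  have h0 : t ^+ n.+1 != 0 by rewrite expf_neq0.
  have h1 : 1 - t ^+ n.+1 != 0 by rewrite subr_eq0 eq_sym.
  have h2 : t ^+ n.+1 - 1 != 0 by rewrite subr_eq0.
  by field; rewrite h0 h1 h2.
rewrite -[X in clim _ X](_ : 1 + -1 * 1 = 0 :> R[i]); last by rewrite mulr1 subrr.
by apply: climD; [exact: clim_cst|exact: climZ].
Qed.

(** The factor omega^i of the mean raises each exponent by one, so the exponents lie between 1 and n
    and none is divisible by [n.+1]: the mean vanishes exactly. *)
Lemma cmean_poly (x : circle) (p : {poly R[i]}) n : (size p <= n)%N ->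
  cmean n x (fun w => p.[w]) = 0.
Proof.
move=> sp; pose q := p \Po ('X + (centre x)%:P).
have qE w : p.[centre x + w] = q.[w] by rewrite /q horner_comp !hornerE addrC.
have sq : size q = size p by rewrite /q size_comp_poly2 ?size_XaddC.
rewrite /cmean (_ : \sum_(i < _) _ = 0) ?mul0r ?mulr0//.
have E (i : 'I_n.+1) : (radius x)%:C * omega n ^+ i * p.[centre x + (radius x)%:C * omega n ^+ i] =
    \sum_(l < size p) q`_l * (radius x)%:C ^+ l.+1 * omega n ^+ (i * l.+1).
  rewrite qE horner_coef sq mulr_sumr; apply: eq_bigr => l _.
  rewrite exprMn exprM exprS [omega n ^+ i ^+ l.+1]exprS; ring.
under eq_bigr do rewrite E.
rewrite exchange_big /= big1// => l _.
rewrite -mulr_sumr sum_omega ?mulr0// gtnNdvd//.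
by rewrite ltnS (leq_trans (ltn_ord l)).
Qed.

End CircleMeans.

Section CauchyFormula.
Context {R : realType}.
Local Notation circle := (R[i] * R[i] * R)%type.
Implicit Types (cs : seq circle) (s : seq R[i]).

Definition off_circles cs (a : R[i]) :=
  forall x, x \in cs -> cnorm (a - centre x) != radius x.

Definition winding cs (a : R[i]) : R[i] :=
  \sum_(x <- cs) weight x * (cnorm (a - centre x) < radius x)%R%:R.

Lemma off_circles_gap cs a : off_circles cs a ->
  exists2 d : R, 0 < d & forall x, x \in cs -> d <= `|cnorm (a - centre x) - radius x|.
Proof.
elim: cs => [_|x cs IH h]; first by exists 1.
have [|d d0 hd] := IH; first by move=> y ycs; apply: h; rewrite inE ycs orbT.
have e0 : 0 < `|cnorm (a - centre x) - radius x|.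
  by rewrite normr_gt0 subr_eq0; apply: h; rewrite mem_head.
exists (Num.min d `|cnorm (a - centre x) - radius x|); first by rewrite lt_min d0.
move=> y; rewrite inE => /orP[/eqP->|ycs]; first by rewrite ge_min lexx orbT.
by rewrite ge_min hd.
Qed.

Lemma off_circles_gap_seq cs s : (forall a, a \in s -> off_circles cs a) ->
  exists2 d : R, 0 < d &
    forall a x, a \in s -> x \in cs -> d <= `|cnorm (a - centre x) - radius x|.
Proof.
elim: s => [_|a s IH h]; first by exists 1.
have [|d d0 hd] := IH; first by move=> y ycs; apply: h; rewrite inE ycs orbT.
have [|e e0 he] := @off_circles_gap cs a; first by apply: h; rewrite mem_head.
exists (Num.min d e); first by rewrite lt_min d0.
move=> b x; rewrite inE => /orP[/eqP->|bs] xcs; rewrite ge_min; apply/orP.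
  by right; apply: he.
by left; apply: hd.
Qed.

Lemma gap_on_circle (x : circle) w a :
  on_circle x w -> `|cnorm (a - centre x) - radius x| <= cnorm (w - a).
Proof.
rewrite /on_circle => <-; rewrite ler_norml; apply/andP; split.
  have := cnorm_subl (w - centre x) (w - a).
  rewrite (_ : w - centre x - (w - a) = a - centre x); last by ring.
  lra.
have := cnorm_tri a (centre x) w; rewrite (cnorm_dist a w); lra.
Qed.

(** Moving by [d / 2] from a point at distance at least [d] from every circle crosses none of
    them. *)
Lemma near_off_circles cs a b (d : R) : 0 < d ->
  (forall x, x \in cs -> d <= `|cnorm (a - centre x) - radius x|) ->
  cnorm (a - b) <= d / 2 ->
  [/\ off_circles cs b, winding cs b = winding cs a &
    forall x, x \in cs -> d / 2 <= `|cnorm (b - centre x) - radius x|].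
Proof.
move=> d0 hd ab.
have h x : x \in cs -> (cnorm (a - centre x) <= radius x - d /\ cnorm (b - centre x) <= radius x
  - d / 2)
     \/ (cnorm (a - centre x) >= radius x + d /\ cnorm (b - centre x) >= radius x + d / 2).
  move=> /hd; have h1 := cnorm_tri b (centre x) a.
  have h2 := cnorm_tri a (centre x) b; rewrite (cnorm_dist b a) in h1.
  by rewrite ler_normr => /orP[]?; [right|left]; split; lra.
split.
- move=> x /h[[h1 h2]|[h1 h2]]; first by rewrite lt_eqF//; lra.
  by rewrite gt_eqF//; lra.
- rewrite /winding !big_seq; apply: eq_bigr => x /h xcs; congr (_ * _%:R).
  case: xcs => -[h1 h2].
    have -> : cnorm (b - centre x) < radius x by lra.
    by have -> : cnorm (a - centre x) < radius x by lra.
  have /negbTE -> : ~~ (cnorm (b - centre x) < radius x) by rewrite -leNgt; lra.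
  by have /negbTE -> : ~~ (cnorm (a - centre x) < radius x) by rewrite -leNgt; lra.
- by move=> x /h xcs; rewrite ler_normr; apply/orP; case: xcs => -[h1 h2]; [right|left]; lra.
Qed.

Definition positive_radii cs := forall x, x \in cs -> 0 < radius x.

Lemma positive_nonneg cs : positive_radii cs -> nonneg_radii cs.
Proof. by move=> h x /h/ltW. Qed.

Lemma lam_pole cs a : positive_radii cs -> off_circles cs a ->
  clim (fun n => lam n cs (fun w => (w - a)^-1)) (winding cs a).
Proof.
move=> cs0 ha; apply: clim_sum => x xcs.
by apply: cmean_pole; [exact: cs0|exact: ha].
Qed.

Lemma lam_poly cs (p : {poly R[i]}) : clim (fun n => lam n cs (fun w => p.[w])) 0.
Proof.
apply/climP => e e0; exists (size p) => //= n /= pn.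
by rewrite /lam big1 ?subrr ?cnorm0// => x _; apply: cmean_poly.
Qed.

(* Partial fractions separate two distinct factors and lower their number; a
   repeated factor is perturbed into a distinct one, uniformly on the circles. *)
Lemma lam_inv_prod cs s v : positive_radii cs ->
  (forall x, x \in cs -> cnorm (weight x) <= 1) ->
  (forall a, a \in s -> off_circles cs a /\ winding cs a = v) ->
  clim (fun n => lam n cs (fun w => (\prod_(a <- s) (w - a))^-1))
    (if size s == 1%N then v else 0).
Proof.
move=> cs0 cs1; have cs0' := positive_nonneg cs0.
have [k] := ubnP (size s); elim: k s => // k IH [|a [|b s]] /=.
- move=> _ _.
  have -> : (fun w => (\prod_(a <- [::]) (w - a))^-1) = fun w => (1 : {poly R[i]}).[w].
    by apply/funext => w; rewrite big_nil invr1 hornerE.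
  exact: lam_poly.
- move=> _ h; have [aoff <-] := h a (mem_head _ _).
  have -> : (fun w => (\prod_(a <- [:: a]) (w - a))^-1) = fun w => (w - a)^-1.
    by apply/funext => w; rewrite big_seq1.
  exact: lam_pole.
move=> sk h.
have nz x y w : x \in cs -> off_circles cs y -> on_circle x w -> w - y != 0.
  move=> xcs yoff xw; rewrite -cnorm_gt0 (lt_le_trans _ (gap_on_circle y xw))//.
  by rewrite normr_gt0 subr_eq0 yoff.
have main c : c != a -> off_circles cs c -> winding cs c = v ->
    clim (fun n => lam n cs (fun w => (\prod_(z <- [:: a, c & s]) (w - z))^-1)) 0.
  move=> ca coff cw.
  have -> : (fun n => lam n cs (fun w => (\prod_(z <- [:: a, c & s]) (w - z))^-1)) =
    fun n => (a - c)^-1 * (lam n cs (fun w => (\prod_(z <- a :: s) (w - z))^-1)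
       + -1 * lam n cs (fun w => (\prod_(z <- c :: s) (w - z))^-1)).
    apply/funext => n; rewrite -lamZ -lamD -lamZ; apply: eq_lam => // x w xcs xw.
    rewrite !big_cons !invfM.
    have h1 : w - a != 0 by apply: (nz x) => //; apply: (h a _).1; rewrite mem_head.
    have h2 : w - c != 0 by apply: (nz x).
    have h3 : a - c != 0 by rewrite subr_eq0 eq_sym.
    by move: (\prod_(j <- s) (w - j))^-1 => Q; field; rewrite h1 h2 h3.
  (* Both products have one factor less and equally many factors, so by induction their limits
     agree, even when this limit is [v], and the difference tends to 0. *)
  suff : clim (fun n => (a - c)^-1 * (lam n cs (fun w => (\prod_(z <- a :: s) (w - z))^-1)
       + -1 * lam n cs (fun w => (\prod_(z <- c :: s) (w - z))^-1)))
     ((a - c)^-1 * ((if size (a :: s) == 1%N then v else 0) +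
     -1 * (if size (c :: s) == 1%N then v else 0))) by rewrite mulN1r subrr mulr0.
  apply: climZ; apply: climD.
    apply: IH => // z; rewrite inE => /orP[/eqP->|zs]; apply: h; rewrite !inE ?eqxx//.
    by rewrite zs !orbT.
  apply: climZ; apply: IH => // z; rewrite inE => /orP[/eqP->|zs] //.
  by apply: h; rewrite !inE zs !orbT.
have [ba|ba] := eqVneq b a; last first.
  have [|boff bw] := h b _; first by rewrite !inE eqxx orbT.
  exact: main.
rewrite {b}ba in sk h *.
have [|d d0 hd] := @off_circles_gap_seq cs [:: a, a & s].
  by move=> z zs; apply: (h _ zs).1.
have [aoff aw] := h a (mem_head _ _).
(* On the circles, (w - a)^2 (w - c) Q has modulus at least d^2 (d / 2) d^(size s); [M] adds up the
   resulting bounds. *)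
pose M : R := \sum_(x <- cs) radius x * (2 / d ^+ (size s).+3).
have M0 : 0 <= M.
  rewrite /M big_seq; apply: sumr_ge0 => x xcs; rewrite mulr_ge0 ?cs0'//.
  by rewrite divr_ge0 ?exprn_ge0 ?ltW.
apply: clim_approx => e e0.
(* The first entry keeps [c] on the same side of each circle as [a], the second keeps the total
   error below [e]. *)
pose y := Num.min (d / 2) (e / (M + 1)).
have y0 : 0 < y by rewrite lt_min !divr_gt0//; lra.
pose c := a + y%:C.
have acy : cnorm (a - c) = y.
  by rewrite /c opprD addNKr cnormN cnorm_realp// ltW.
have [coff cw cgap] : [/\ off_circles cs c, winding cs c = winding cs a &
    forall x, x \in cs -> d / 2 <= `|cnorm (c - centre x) - radius x|].
  apply: near_off_circles => //; first by move=> x xcs; apply: hd; rewrite // mem_head.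
  by rewrite acy ge_min lexx.
exists (fun n => lam n cs (fun w => (\prod_(z <- [:: a, c & s]) (w - z))^-1)); last first.
  apply: main; rewrite ?cw// -subr_eq0 -cnorm_eq0 cnorm_dist acy gt_eqF//.
move=> n; rewrite -mulN1r -lamZ -lamD.
apply: (@le_trans _ _ (\sum_(x <- cs) radius x * (y * (2 / d ^+ (size s).+3)))).
  apply: lam_bound => // x w xcs xw.
  have h1 : w - a != 0 by apply: (nz x).
  have h2 : w - c != 0 by apply: (nz x).
  set Q := \prod_(z <- s) (w - z).
  have hQ : d ^+ size s <= cnorm Q.
    rewrite /Q cnorm_prod; have : forall z, z \in s -> d <= cnorm (w - z).
      move=> z zs; apply: le_trans (gap_on_circle z xw).
      by apply: hd => //; rewrite !inE zs !orbT.
    elim: (s) => [|z t IHt] ht; first by rewrite big_nil expr0.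
    rewrite big_cons /= exprS; apply: ler_pM; rewrite ?exprn_ge0 ?(ltW d0)//.
      by apply: ht; rewrite mem_head.
    by apply: IHt => u ut; apply: ht; rewrite inE ut orbT.
  have Q0 : Q != 0 by rewrite -cnorm_gt0; apply: lt_le_trans hQ; rewrite exprn_gt0.
  rewrite !big_cons -/Q (_ : _ + _ = (a - c) * ((w - a) ^+ 2 * (w - c) * Q)^-1).
    have hd2 : 0 < d ^+ (size s).+3 / 2 by rewrite divr_gt0// exprn_gt0.
    have le_den : d ^+ (size s).+3 / 2 <= cnorm ((w - a) ^+ 2 * (w - c) * Q).
      have -> : d ^+ (size s).+3 / 2 = d ^+ 2 * (d / 2) * d ^+ size s.
        by rewrite !exprSr; field.
      have ha : d <= cnorm (w - a).
        by apply: le_trans (gap_on_circle a xw); apply: hd; rewrite ?mem_head.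
      have hc : d / 2 <= cnorm (w - c).
        exact: le_trans (cgap _ xcs) (gap_on_circle c xw).
      have d20 : 0 <= d / 2 by rewrite divr_ge0// ltW.
      rewrite (cnormM _ Q) (cnormM _ (w - c)) cnormX; apply: ler_pM => //; rewrite ?mulr_ge0
        ?exprn_ge0 ?(ltW d0)//.
      by apply: ler_pM; rewrite ?exprn_ge0 ?(ltW d0)// lerXn2r ?nnegrE ?cnorm_ge0 ?(ltW d0).
    rewrite cnormM acy ler_wpM2l ?(ltW y0)// cnormV -[2 / _]invf_div.
    by rewrite lef_pV2 ?posrE// (lt_le_trans hd2).
  by field; rewrite h1 h2 Q0.
under eq_bigr do rewrite mulrCA.
rewrite -mulr_sumr -/M (@le_trans _ _ (e / (M + 1) * (M + 1)))//.
  by rewrite ler_pM ?(ltW y0) ?ge_min ?lexx ?orbT//; lra.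
by rewrite divfK//; lra.
Qed.

End CauchyFormula.

(** * Taylor coefficients of quotients of polynomials *)

Section TaylorCoefficients.
Context {R : realType}.
Local Notation circle := (R[i] * R[i] * R)%type.
Implicit Types (cs : seq circle) (p q : {poly R[i]}) (z : R[i]).

(** Writing p = p(a) + (X - a) p1 leaves p1 over one factor less and a constant over the full
    product; the latter tends to 0 since every pole has winding number 0. *)
Lemma lam_ratio_prod cs (s : seq R[i]) p : positive_radii cs ->
  (forall x, x \in cs -> cnorm (weight x) <= 1) ->
  (forall a, a \in s -> off_circles cs a /\ winding cs a = 0) ->
  clim (fun n => lam n cs (fun w => p.[w] / \prod_(a <- s) (w - a))) 0.
Proof.
move=> cs0 cs1; elim: s p => [|a s IH] p h.
  have -> : (fun w => p.[w] / \prod_(a <- [::]) (w - a)) = fun w => p.[w].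
    by apply/funext => w; rewrite big_nil invr1 mulr1.
  exact: lam_poly.
have /factor_theorem[p1 pE] : root (p - p.[a]%:P) a.
  by rewrite /root !hornerE subrr.
have [aoff aw] := h a (mem_head _ _).
have -> : (fun n => lam n cs (fun w => p.[w] / \prod_(z <- a :: s) (w - z))) =
    fun n => lam n cs (fun w => p1.[w] / \prod_(z <- s) (w - z)) +
      p.[a] * lam n cs (fun w => (\prod_(z <- a :: s) (w - z))^-1).
  apply/funext => n; rewrite -lamZ -lamD; apply: eq_lam; first exact: positive_nonneg.
  move=> x w xcs xw; rewrite -[p in p.[w]](subrK p.[a]%:P) pE !hornerE.
  have h1 : w - a != 0.
    by rewrite -cnorm_gt0 (lt_le_trans _ (gap_on_circle a xw))// normr_gt0 subr_eq0 aoff.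
  rewrite big_cons invfM; move: (\prod_(j <- s) (w - j))^-1 => Q.
  by field.
suff : clim (fun n => lam n cs (fun w => p1.[w] / \prod_(z <- s) (w - z)) +
    p.[a] * lam n cs (fun w => (\prod_(z <- a :: s) (w - z))^-1)) (0 + p.[a] * 0).
  by rewrite mulr0 addr0.
apply: climD; first by apply: IH => b bs; apply: h; rewrite inE bs orbT.
apply: climZ; have := lam_inv_prod cs0 cs1 h.
by rewrite if_same.
Qed.

Lemma lam_ratio cs p q : positive_radii cs ->
  (forall x, x \in cs -> cnorm (weight x) <= 1) -> q != 0 ->
  (forall a, root q a -> off_circles cs a /\ winding cs a = 0) ->
  clim (fun n => lam n cs (fun w => p.[w] / q.[w])) 0.
Proof.
move=> cs0 cs1 q0 h; have [s qE] := closed_field_poly_normal q.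
have hs a : a \in s -> off_circles cs a /\ winding cs a = 0.
  by move=> as_; apply: h; rewrite qE rootZ ?lead_coef_eq0// root_prod_XsubC.
suff -> : (fun w => p.[w] / q.[w]) =
    fun w => ((lead_coef q)^-1 *: p).[w] / \prod_(a <- s) (w - a).
  exact: lam_ratio_prod.
apply/funext => w; rewrite {1}qE !hornerZ horner_prod invfM mulrCA mulrA.
by congr (_ / _); apply: eq_bigr => a _; rewrite !hornerE.
Qed.

(* The circles of [cs], weighted, form a cycle homologous to 0 off the poles
   and winding once around [z]. *)
Definition cauchy_cycle cs q z :=
  [/\ positive_radii cs, (forall x, x \in cs -> cnorm (weight x) <= 1),
      (forall a, root q a -> off_circles cs a /\ winding cs a = 0) &
      off_circles cs z /\ winding cs z = 1].

Definition cauchy_kernel z k (w : R[i]) := (w - z) ^- k.+1.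

Lemma off_circles_root cs q : (forall a, root q a -> off_circles cs a) ->
  forall x w, x \in cs -> on_circle x w -> q.[w] != 0.
Proof.
move=> h x w xcs xw; apply/negP => /h /(_ x xcs) /eqP; apply; exact: xw.
Qed.

Lemma lam_cauchy_kernel cs q z k : cauchy_cycle cs q z ->
  clim (fun n => lam n cs (cauchy_kernel z k)) (k == 0%N)%:R.
Proof.
move=> [cs0 cs1 _ [zoff zw]].
have -> : cauchy_kernel z k = fun w => (\prod_(a <- nseq k.+1 z) (w - a))^-1.
  by apply/funext => w; rewrite big_nseq iter_mulr_1.
have := @lam_inv_prod _ cs (nseq k.+1 z) 1 cs0 cs1; rewrite size_nseq eqSS.
rewrite [X in clim _ X](_ : _ = (k == 0%N)%:R); last by case: (k == 0%N).
by apply=> a; rewrite mem_nseq => /andP[_ /eqP->].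
Qed.

(** The limit is found by algebra: if p = c q + (X - z) p1, the coefficient of order k + 1 of p / q
    is that of order k of p1 / q. The recursion never mentions a cycle, so all Cauchy cycles give
    the same number. *)
Lemma taylor_coef_exists p q z k : q.[z] != 0 -> exists t,
  (k = 0%N -> t = p.[z] / q.[z]) /\
  forall cs, cauchy_cycle cs q z ->
    clim (fun n => lam n cs (fun w => p.[w] / q.[w] * cauchy_kernel z k w)) t.
Proof.
move=> qz0; have q0 : q != 0 by apply: contraNneq qz0 => ->; rewrite horner0.
have E p' p1 c w k' : p' - c *: q = p1 * ('X - z%:P) -> w - z != 0 -> q.[w] != 0 ->
    p'.[w] / q.[w] * cauchy_kernel z k' w =
    c * cauchy_kernel z k' w + p1.[w] / q.[w] * (w - z) ^- k'.
  move=> pE wz qw; rewrite -[p'](subrK (c *: q)) pE !hornerE /cauchy_kernel exprS.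
  have wk : (w - z) ^+ k' != 0 by rewrite expf_neq0.
  by move: ((w - z) ^+ k') wk => W wk; field; rewrite wk wz qw.
have nz cs x w : cauchy_cycle cs q z -> x \in cs -> on_circle x w ->
    w - z != 0 /\ q.[w] != 0.
  move=> [cs0 cs1 hq [zoff _]] xcs xw; split; last first.
    by apply: (off_circles_root _ xcs xw) => a /hq[].
  rewrite -cnorm_gt0 (lt_le_trans _ (gap_on_circle z xw))//.
  by rewrite normr_gt0 subr_eq0 zoff.
have div p' : exists p1, p' - (p'.[z] / q.[z]) *: q = p1 * ('X - z%:P).
  by apply/factor_theorem; rewrite /root !hornerE divfK// subrr.
elim: k p => [|k IH] p; set c := p.[z] / q.[z]; have [p1 pE] := div p.
- exists c; split=> // cs hcs; have [cs0 cs1 hq _] := hcs.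
  have -> : (fun n => lam n cs (fun w => p.[w] / q.[w] * cauchy_kernel z 0 w)) =
      fun n => c * lam n cs (cauchy_kernel z 0) + lam n cs (fun w => p1.[w] / q.[w]).
    apply/funext => n; rewrite -lamZ -lamD; apply: eq_lam; first exact: positive_nonneg.
    by move=> x w xcs xw; have [wz qw] := nz _ _ _ hcs xcs xw; rewrite (E _ _ _ _ _ pE)// expr0
      invr1 mulr1.
  suff : clim (fun n => c * lam n cs (cauchy_kernel z 0) +
    lam n cs (fun w => p1.[w] / q.[w])) (c * (0%N == 0%N)%:R + 0) by rewrite eqxx mulr1 addr0.
  by apply: climD; [apply: climZ; exact: lam_cauchy_kernel hcs|exact: lam_ratio].
have [t [_ ht]] := IH p1.
exists t; split=> // cs hcs; have [cs0 cs1 hq _] := hcs.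
have -> : (fun n => lam n cs (fun w => p.[w] / q.[w] * cauchy_kernel z k.+1 w)) =
    fun n => c * lam n cs (cauchy_kernel z k.+1) +
      lam n cs (fun w => p1.[w] / q.[w] * cauchy_kernel z k w).
  apply/funext => n; rewrite -lamZ -lamD; apply: eq_lam; first exact: positive_nonneg.
  by move=> x w xcs xw; have [wz qw] := nz _ _ _ hcs xcs xw; rewrite (E _ _ _ _ _ pE).
suff : clim (fun n => c * lam n cs (cauchy_kernel z k.+1) +
    lam n cs (fun w => p1.[w] / q.[w] * cauchy_kernel z k w)) (c * (k.+1 == 0%N)%:R + t).
  by rewrite mulr0 add0r.
by apply: climD; [apply: climZ; exact: lam_cauchy_kernel hcs|exact: ht].
Qed.

(** Characterised by its property on all Cauchy cycles at once, so that the cycle may change from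
    one estimate to the next. *)
Definition taylor_coef p q k z : R[i] := xget 0 [set t |
  (k = 0%N -> t = p.[z] / q.[z]) /\
  forall cs, cauchy_cycle cs q z ->
    clim (fun n => lam n cs (fun w => p.[w] / q.[w] * cauchy_kernel z k w)) t].

Lemma taylor_coef0 p q z : q.[z] != 0 -> taylor_coef p q 0 z = p.[z] / q.[z].
Proof.
move=> qz0; have [h _] := xgetPex 0 (taylor_coef_exists p 0 qz0).
exact: h.
Qed.

Lemma lam_taylor_coef p q k z cs : q.[z] != 0 -> cauchy_cycle cs q z ->
  clim (fun n => lam n cs (fun w => p.[w] / q.[w] * cauchy_kernel z k w))
    (taylor_coef p q k z).
Proof.
by move=> qz0; have [_] := xgetPex 0 (taylor_coef_exists p k qz0); apply.
Qed.

Lemma inv_pow_diff (a b h : R[i]) (D : R) n : a - b = h * (a * b) ->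
  cnorm a <= D -> cnorm b <= D ->
  cnorm (a ^+ n - b ^+ n) <= n%:R * cnorm h * D ^+ n.+1.
Proof.
move=> abh aD bD; have D0 : 0 <= D := le_trans (cnorm_ge0 _) aD.
elim: n => [|n IH]; first by rewrite subrr cnorm0 !mul0r.
have -> : a ^+ n.+1 - b ^+ n.+1 = a * (a ^+ n - b ^+ n) + h * (a * b * b ^+ n).
  by rewrite !exprS !mulrA -[h * a * b]mulrA -abh; ring.
rewrite (le_trans (cnormD _ _))// !cnormM cnormX.
rewrite (_ : _ * D ^+ n.+2 = D * (n%:R * cnorm h * D ^+ n.+1) + cnorm h * (D * D * D ^+ n)).
  apply: lerD; first by rewrite ler_pM ?cnorm_ge0.
  rewrite ler_wpM2l ?cnorm_ge0// ler_pM ?mulr_ge0 ?exprn_ge0 ?cnorm_ge0//.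
    by rewrite ler_pM ?cnorm_ge0.
  by rewrite lerXn2r ?nnegrE ?cnorm_ge0.
by rewrite -natr1 !exprS; ring.
Qed.

(** With a = 1 / (w - z'), b = 1 / (w - z) and h = z' - z this is the second order remainder of a
    Cauchy kernel. The constant n^2 closes the induction because n^2 + n + 1 <= (n + 1)^2. *)
Lemma inv_pow_diff2 (a b h : R[i]) (D : R) n : a - b = h * (a * b) ->
  cnorm a <= D -> cnorm b <= D ->
  cnorm (a ^+ n - b ^+ n - n%:R * h * b ^+ n.+1) <= (n ^ 2)%:R * cnorm h ^+ 2 * D ^+ n.+2.
Proof.
move=> abh aD bD; have D0 : 0 <= D := le_trans (cnorm_ge0 _) aD.
elim: n => [|n IH].
  by rewrite !expr0 subrr !mul0r subr0 cnorm0.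
have -> : a ^+ n.+1 - b ^+ n.+1 - n.+1%:R * h * b ^+ n.+2 =
    b * (a ^+ n - b ^+ n - n%:R * h * b ^+ n.+1) + h * b * (a ^+ n.+1 - b ^+ n.+1).
  have h1 : a ^+ n.+1 = b * a ^+ n + h * a * b * a ^+ n.
    by rewrite exprS -[h * a * b]mulrA -abh; ring.
  rewrite {1}h1 !exprS -natr1; ring.
rewrite (le_trans (cnormD _ _))// !cnormM.
have h2 := inv_pow_diff n.+1 abh aD bD.
apply: (@le_trans _ _ (D * ((n ^ 2)%:R * cnorm h ^+ 2 * D ^+ n.+2) +
   cnorm h * D * (n.+1%:R * cnorm h * D ^+ n.+2))).
  apply: lerD; first by rewrite ler_pM ?cnorm_ge0.
  by rewrite ler_pM ?mulr_ge0 ?cnorm_ge0// ler_wpM2l ?cnorm_ge0.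
rewrite (_ : _ + _ = (n ^ 2 + n.+1)%:R * cnorm h ^+ 2 * D ^+ n.+3).
  rewrite ler_wpM2r ?exprn_ge0// ler_wpM2r ?exprn_ge0 ?cnorm_ge0// ler_nat; nia.
by rewrite natrD !exprS; ring.
Qed.

End TaylorCoefficients.

(** * Cauchy estimates on R(X) *)

Section Completeness.
Context {R : realType}.

Lemma real_cauchy (u : nat -> R) :
  (forall e, 0 < e -> exists N, forall m, (N <= m)%N -> `|u N - u m| < e) ->
  exists v : R, u @ \oo --> v.
Proof.
move=> h; suff /cauchy_cvgP : cauchy (u @ \oo) by move=> c; exists (lim (u @ \oo)).
apply: cauchy_exP => e /h[N hN]; exists (u N).
by exists N => // m /= Nm; apply: hN.
Qed.

Lemma complex_cauchy (u : nat -> R[i]) :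
  (forall e, 0 < e -> exists N, forall m, (N <= m)%N -> cnorm (u N - u m) < e) ->
  exists v, clim u v.
Proof.
move=> h.
have [a ha] : exists a : R, (fun n => complex.Re (u n)) @ \oo --> a.
  apply: real_cauchy => e /h[N hN]; exists N => m /hN; apply: le_lt_trans.
  by rewrite -raddfB cnorm_Re.
have [b hb] : exists b : R, (fun n => complex.Im (u n)) @ \oo --> b.
  apply: real_cauchy => e /h[N hN]; exists N => m /hN; apply: le_lt_trans.
  by rewrite -raddfB cnorm_Im.
exists (a +i* b); apply: (@clim_le _ _ _
  (fun n => `|complex.Re (u n) - a| + `|complex.Im (u n) - b|)).
  by move=> n; apply: (le_trans (cnorm_le_ReIm _)); case: (u n).
rewrite -[0]addr0; apply: cvgD.
  rewrite -[0](@normr0 _ R) -(subrr a); apply: cvg_norm.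
  by apply: cvgB => //; apply: cvg_cst.
rewrite -[0](@normr0 _ R) -(subrr b); apply: cvg_norm.
by apply: cvgB => //; apply: cvg_cst.
Qed.

End Completeness.

Section RationalAlgebra.
Context {R : realType}.
Implicit Types (X : set R[i]) (f : R[i] -> R[i]) (p q : {poly R[i]}).

Lemma entourage_cnormP (A : set (R[i] * R[i])) :
  entourage A <-> exists2 d : R, 0 < d & forall z w, cnorm (z - w) < d -> A (z, w).
Proof.
rewrite -entourage_ballE; split.
  move=> [e /= /gt0_complex[d d0 ->]] h; exists d => // z w zw.
  by apply: h; apply/ball_cnorm.
move=> [d d0 h]; exists d%:C; first by rewrite /= ltcR.
by move=> [z w] /ball_cnorm; apply: h.
Qed.

Lemma closure_rational_onP X f :
  closure (rational_on X : set {uniform` X -> R[i]}) f <->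
  forall e : R, 0 < e -> exists p q, forall z, X z ->
    q.[z] != 0 /\ cnorm (f z - p.[z] / q.[z]) < e.
Proof.
split=> [h e e0|h A /uniform_nbhs[E [/entourage_cnormP[d d0 dE] EA]]].
  have [|g [[p [q gE]] fg]] := h [set g | forall z, X z -> cnorm (f z - g z) < e].
    apply/uniform_nbhs; exists [set zw | cnorm (zw.1 - zw.2) < e]; split=> //.
    by apply/entourage_cnormP; exists e.
  by exists p, q => z Xz; have [qz <-] := gE z Xz; split=> //; apply: fg.
have [p [q pq]] := h _ d0.
exists (fun z => p.[z] / q.[z]); split.
  by exists p, q => z /pq[].
by apply: EA => z Xz; apply: dE; have [] := pq z Xz.
Qed.

End RationalAlgebra.

Section CauchyEstimates.
Context {R : realType}.
Local Notation circle := (R[i] * R[i] * R)%type.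
Variables (X I : set R[i]) (M : nat -> R).
Implicit Types (cs : seq circle) (p q : {poly R[i]}) (z : R[i]).

(* [d] bounds from below the distance from [I] to each circle. *)
Definition adapted_cycle cs (d : circle -> R) p q (B : R) :=
  [/\ positive_radii cs, (forall x, x \in cs -> cnorm (weight x) <= 1),
      (forall a, root q a -> off_circles cs a /\ winding cs a = 0),
      (forall z, I z -> off_circles cs z /\ winding cs z = 1) &
   [/\ (forall x w, x \in cs -> on_circle x w -> cnorm p.[w] <= B * cnorm q.[w]),
       (forall x, x \in cs -> 0 < d x),
       (forall x w z, x \in cs -> on_circle x w -> I z -> d x <= cnorm (w - z)) &
       (forall k, \sum_(x <- cs) radius x * d x ^- k.+1 <= M k)]].

(** [M] is fixed before [p] and [q]; only the cycle depends on them, which makes the estimates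
    uniform over quotients. The product form |p| < B |q| also forces [q] to have no zero on [X]. *)
Definition cauchy_system := forall p q (B : R), 0 < B ->
  (forall z, X z -> cnorm p.[z] < B * cnorm q.[z]) ->
  exists cs d, adapted_cycle cs d p q B.

Lemma adapted_bound cs d p q (B A : R) k (K : R[i] -> R[i]) n :
  0 <= A -> 0 < B -> adapted_cycle cs d p q B ->
  (forall x w, x \in cs -> on_circle x w -> cnorm (K w) <= A * d x ^- k.+1) ->
  cnorm (lam n cs (fun w => p.[w] / q.[w] * K w)) <= A * B * M k.
Proof.
move=> A0 B0 [cs0 cs1 hq hI [pq d0 dI hM]] hK.
apply: (@le_trans _ _ (\sum_(x <- cs) radius x * (B * (A * d x ^- k.+1)))).
  apply: lam_bound => //; first exact: positive_nonneg.
  move=> x w xcs xw; rewrite cnormM; apply: ler_pM; rewrite ?cnorm_ge0 ?hK//.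
  have q0 : q.[w] != 0 by apply: (off_circles_root _ xcs xw) => a /hq[].
  by rewrite cnorm_div ler_pdivrMr ?cnorm_gt0// (pq x).
under eq_bigr do rewrite mulrCA [radius _ * _]mulrCA mulrA.
by rewrite -mulr_sumr [B * A]mulrC ler_wpM2l// mulr_ge0// ltW.
Qed.

Lemma adapted_cauchy_cycle cs d p q q' B z : adapted_cycle cs d p q B -> I z ->
  (forall a, root q' a -> root q a) -> cauchy_cycle cs q' z.
Proof. by move=> [? ? hq hI _] Iz qq'; split=> //; [move=> a /qq'/hq|exact: hI]. Qed.

Hypothesis IX : I `<=` X.
Hypothesis hX : cauchy_system.

Lemma adapted_nz p q B z : 0 < B -> (forall z, X z -> cnorm p.[z] < B * cnorm q.[z]) ->
  X z -> q.[z] != 0.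
Proof.
move=> B0 h /h; apply: contraTneq => ->.
by rewrite cnorm0 mulr0 -leNgt cnorm_ge0.
Qed.

Lemma kernel_bound cs d p q B x w z k : adapted_cycle cs d p q B ->
  x \in cs -> on_circle x w -> I z -> cnorm (cauchy_kernel z k w) <= d x ^- k.+1.
Proof.
move=> [_ _ _ _ [_ d0 dI _]] xcs xw Iz; rewrite /cauchy_kernel cnormV cnormX.
have dx := d0 _ xcs; have dw := dI _ _ _ xcs xw Iz.
rewrite lef_pV2 ?posrE ?exprn_gt0// ?(lt_le_trans dx)//.
by rewrite lerXn2r ?nnegrE ?cnorm_ge0 ?(ltW dx).
Qed.

Lemma taylor_coef_le p q B k z : 0 < B ->
  (forall z, X z -> cnorm p.[z] < B * cnorm q.[z]) -> I z ->
  cnorm (taylor_coef p q k z) <= B * M k.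
Proof.
move=> B0 pq Iz; have [cs [d ad]] := hX B0 pq.
have qz := adapted_nz B0 pq (IX Iz).
apply: (clim_cnorm_le (lam_taylor_coef p k qz (adapted_cauchy_cycle ad Iz _))) => // n.
rewrite -[B]mul1r; apply: (adapted_bound n _ B0 ad) => // x w xcs xw.
by rewrite mul1r (kernel_bound _ ad).
Qed.

(** Over the common denominator q1 q2, a single cycle is a Cauchy cycle for q1 as well as for q2,
    hence computes both coefficients and their difference. *)
Lemma taylor_coef_dist p1 q1 p2 q2 B k z : 0 < B ->
  (forall z, X z -> [/\ q1.[z] != 0, q2.[z] != 0 &
     cnorm (p1.[z] / q1.[z] - p2.[z] / q2.[z]) < B]) -> I z ->
  cnorm (taylor_coef p1 q1 k z - taylor_coef p2 q2 k z) <= B * M k.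
Proof.
move=> B0 pq Iz; pose p := p1 * q2 - p2 * q1; pose q := q1 * q2.
have E w : q1.[w] != 0 -> q2.[w] != 0 ->
    p1.[w] / q1.[w] - p2.[w] / q2.[w] = p.[w] / q.[w].
  by move=> h1 h2; rewrite !hornerE; field; rewrite h1 h2.
have pq' w : X w -> cnorm p.[w] < B * cnorm q.[w].
  move=> /pq[h1 h2]; rewrite E// cnorm_div ltr_pdivrMr// cnorm_gt0.
  by rewrite hornerM mulf_neq0.
have [cs [d ad]] := hX B0 pq'.
have [q1z q2z _] := pq _ (IX Iz).
have c1 : cauchy_cycle cs q1 z.
  by apply: (adapted_cauchy_cycle ad Iz) => a qa; rewrite rootM qa.
have c2 : cauchy_cycle cs q2 z.
  by apply: (adapted_cauchy_cycle ad Iz) => a qa; rewrite rootM qa orbT.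
have l1 := lam_taylor_coef p1 k q1z c1.
have l2 := climZ (-1) (lam_taylor_coef p2 k q2z c2).
rewrite -[- _]mulN1r; apply: (clim_cnorm_le (climD l1 l2)) => n.
rewrite -lamZ -lamD -[B]mul1r.
rewrite (@eq_lam _ _ _ _ (fun w => p.[w] / q.[w] * cauchy_kernel z k w)).
- apply: (adapted_bound n _ B0 ad) => // x w xcs xw.
  by rewrite mul1r (kernel_bound _ ad).
- by case: ad => /positive_nonneg.
move=> x w xcs xw; have [_ _ hq _ _] := ad.
have : q.[w] != 0 by apply: (off_circles_root _ xcs xw) => a /hq[].
rewrite hornerM mulf_eq0 negb_or => /andP[h1 h2].
by rewrite -hornerM -/q -E// mulN1r mulrBl.
Qed.

(** One cycle serves both points. The kernel remainder is of the order of the distance to the power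
    -(k + 3), whence [M k.+2]. *)
Lemma taylor_coef_diff p q B k z z' : 0 < B ->
  (forall z, X z -> cnorm p.[z] < B * cnorm q.[z]) -> I z -> I z' ->
  cnorm (taylor_coef p q k z' - taylor_coef p q k z -
    k.+1%:R * (z' - z) * taylor_coef p q k.+1 z) <=
  (k.+1 ^ 2)%:R * cnorm (z' - z) ^+ 2 * B * M k.+2.
Proof.
move=> B0 pq Iz Iz'; have [cs [d ad]] := hX B0 pq.
have qz := adapted_nz B0 pq (IX Iz); have qz' := adapted_nz B0 pq (IX Iz').
have cz : cauchy_cycle cs q z by apply: (adapted_cauchy_cycle ad Iz).
have cz' : cauchy_cycle cs q z' by apply: (adapted_cauchy_cycle ad Iz').
have l1 := lam_taylor_coef p k qz' cz'.
have l2 := climZ (-1) (lam_taylor_coef p k qz cz).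
have l3 := climZ (- (k.+1%:R * (z' - z))) (lam_taylor_coef p k.+1 qz cz).
rewrite -[- taylor_coef _ _ _ _]mulN1r -mulNr.
apply: (clim_cnorm_le (climD (climD l1 l2) l3)) => n.
rewrite -!lamZ -!lamD.
rewrite (@eq_lam _ _ _ _ (fun w => p.[w] / q.[w] * (cauchy_kernel z' k w -
   cauchy_kernel z k w - k.+1%:R * (z' - z) * cauchy_kernel z k.+1 w))).
- apply: (adapted_bound n _ B0 ad) => [|x w xcs xw].
    by rewrite mulr_ge0 ?exprn_ge0 ?cnorm_ge0.
  have [_ _ _ _ [_ d0 dI _]] := ad.
  have dx := d0 _ xcs; have dz := dI _ _ _ xcs xw Iz; have dz' := dI _ _ _ xcs xw Iz'.
  have wz : w - z != 0 by rewrite -cnorm_gt0 (lt_le_trans dx).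
  have wz' : w - z' != 0 by rewrite -cnorm_gt0 (lt_le_trans dx).
  rewrite /cauchy_kernel -!exprVn; apply: inv_pow_diff2.
  + by field; rewrite wz wz'.
  + by rewrite cnormV lef_pV2 ?posrE ?cnorm_gt0.
  + by rewrite cnormV lef_pV2 ?posrE ?cnorm_gt0.
- by case: ad => /positive_nonneg.
by move=> x w xcs xw; ring.
Qed.

End CauchyEstimates.

Section TaylorLimits.
Context {R : realType}.
Variables (X I : set R[i]) (M : nat -> R).
Hypothesis IX : I `<=` X.
Hypothesis hX : cauchy_system X I M.

(** [F k] is the limit of the coefficients of order [k] of quotients converging to [f], and will
    turn out to be f^(k) / k!. The quotients stay within 1 of [f] on [X], whence [B + 1]. *)
Lemma closure_rational_taylor (f : R[i] -> R[i]) (B : R) : 0 < B ->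
  (forall e : R, 0 < e -> exists p q, forall z, X z ->
    q.[z] != 0 /\ cnorm (f z - p.[z] / q.[z]) < e) ->
  (forall z, X z -> cnorm (f z) < B) ->
  exists F : nat -> R[i] -> R[i],
   [/\ forall z, I z -> F 0%N z = f z,
      forall k z, I z -> cnorm (F k z) <= (B + 1) * M k &
      forall k z z', I z -> I z' ->
        cnorm (F k z' - F k z - k.+1%:R * (z' - z) * F k.+1 z) <=
        (k.+1 ^ 2)%:R * cnorm (z' - z) ^+ 2 * (B + 1) * M k.+2].
Proof.
move=> B0 happ fB; have B10 : 0 < B + 1 by lra.
have /choice[pq hpq] : forall m : nat, exists pq : {poly R[i]} * {poly R[i]},
    forall z, X z -> pq.2.[z] != 0 /\ cnorm (f z - pq.1.[z] / pq.2.[z]) < m.+1%:R^-1.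
  move=> m; have [|p [q h]] := happ m.+1%:R^-1; first by rewrite invr_gt0 ltr0n.
  by exists (p, q).
pose T m k z := taylor_coef (pq m).1 (pq m).2 k z.
have Tq m z : X z -> (pq m).2.[z] != 0 by move=> /(hpq m)[].
have Tb m z : X z -> cnorm (pq m).1.[z] < (B + 1) * cnorm (pq m).2.[z].
  move=> Xz; have [qz h] := hpq m z Xz.
  rewrite -ltr_pdivrMr ?cnorm_gt0// -cnorm_div.
  rewrite -[_ / _](subKr (f z)) (le_lt_trans (cnormB _ _))// ltrD ?fB//.
  by rewrite (lt_le_trans h)// invf_le1// ler1n.
have Td k z m l : I z -> cnorm (T m k z - T l k z) <= (m.+1%:R^-1 + l.+1%:R^-1) * M k.
  move=> Iz; apply: (taylor_coef_dist IX hX) => //.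
  move=> w Xw; have [q1 h1] := hpq m w Xw; have [q2 h2] := hpq l w Xw; split=> //.
  rewrite (le_lt_trans (cnorm_tri _ _ (f w)))// ltrD//.
  by rewrite cnorm_dist.
have Tlim k z : I z -> exists v, clim (fun m => T m k z) v.
  move=> Iz; apply: complex_cauchy => e e0.
  have c0 : 0 < e / (2 * (`|M k| + 1)) by rewrite divr_gt0// mulr_gt0// ltr_wpDl.
  have [N _ hN] := near_infty_natSinv_lt (PosNum c0).
  exists N => m Nm; apply: (le_lt_trans (Td k z N m Iz)).
  have h1 : N.+1%:R^-1 < e / (2 * (`|M k| + 1)) by apply: hN => /=.
  have h2 : m.+1%:R^-1 < e / (2 * (`|M k| + 1)) by apply: hN => /=.
  apply: (@le_lt_trans _ _ ((N.+1%:R^-1 + m.+1%:R^-1) * (`|M k| + 1))).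
    apply: ler_wpM2l; first by rewrite addr_ge0// invr_ge0.
    by rewrite (le_trans (ler_norm _))// lerDl.
  rewrite -ltr_pdivlMr ?ltr_wpDl//.
  have -> : e / (`|M k| + 1) = e / (2 * (`|M k| + 1)) + e / (2 * (`|M k| + 1)).
    have : `|M k| + 1 != 0 by rewrite gt_eqF// ltr_wpDl.
    by move=> h; field.
  by rewrite ltrD.
pose F k z := xget 0 [set v | clim (fun m => T m k z) v].
have FT k z : I z -> clim (fun m => T m k z) (F k z).
  by move=> /(Tlim k)/(xgetPex 0).
exists F; split.
- move=> z Iz; apply: clim_unique (FT 0%N z Iz) _.
  apply: (@clim_le _ _ _ (fun m => m.+1%:R^-1)); last exact: cvg_harmonic.
  move=> m; have [qz h] := hpq m z (IX Iz).
  by rewrite /T taylor_coef0// cnorm_dist ltW.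
- move=> k z Iz; apply: clim_cnorm_le (FT k z Iz) _ => m.
  by apply: (taylor_coef_le IX hX) => // w; apply: Tb.
move=> k z z' Iz Iz'; rewrite -[- F k z]mulN1r -mulNr.
have l2 := climZ (-1) (FT k z Iz).
have l3 := climZ (- (k.+1%:R * (z' - z))) (FT k.+1 z Iz).
apply: clim_cnorm_le (climD (climD (FT k z' Iz') l2) l3) _ => m.
rewrite mulN1r mulNr; apply: (taylor_coef_diff IX hX) => // w; exact: Tb.
Qed.

End TaylorLimits.

(** * Derivatives along a set without isolated points *)

Section DerivativesFromTaylor.
Context {R : realType}.
Variables (S : set R[i]) (f : R[i] -> R[i]) (F : nat -> R[i] -> R[i]) (K : nat -> R).
Hypothesis S_perfect : forall x (d : R), S x -> 0 < d ->
  exists w, [/\ S w, w != x & cnorm (x - w) < d].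
Hypothesis F0 : forall z, S z -> F 0%N z = f z.
Hypothesis F_diff : forall k z z', S z -> S z' ->
  cnorm (F k z' - F k z - k.+1%:R * (z' - z) * F k.+1 z) <= K k * cnorm (z' - z) ^+ 2.

Lemma within_dnbhsP x (A : set R[i]) : (within S x^') A <->
  exists2 d : R, 0 < d & forall w, S w -> w != x -> cnorm (x - w) < d -> A w.
Proof.
split.
  move=> /nbhs_cnormP[d d0 h]; exists d => // w Sw wx xw.
  exact: h.
move=> [d d0 h]; apply/nbhs_cnormP; exists d => // w xw wx Sw.
exact: h.
Qed.

(** Properness makes the limit of the difference quotients unique, so that [lim] in [derive_within]
    returns it. *)
Lemma within_dnbhs_proper x : S x -> ProperFilter (within S x^').
Proof.
move=> Sx; split; last by apply: within_filter.
move=> /within_dnbhsP[d d0 h]; have [w [Sw wx xw]] := S_perfect Sx d0.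
exact: h Sw wx xw.
Qed.

Lemma difference_quotients_cvg k g x : S x ->
  (forall z, S z -> g z = k`!%:R * F k z) ->
  difference_quotients S g x --> (k.+1`!%:R * F k.+1 x : R[i]).
Proof.
move=> Sx gE; have FF := within_dnbhs_proper Sx.
apply/cvg_cnormP => e e0; apply/within_dnbhsP.
have c0 : 0 < k`!%:R * (`|K k| + 1) :> R by rewrite mulr_gt0 ?ltr0n ?fact_gt0// ltr_wpDl.
exists (e / (k`!%:R * (`|K k| + 1))); first by rewrite divr_gt0.
move=> w Sw wx xw /=; rewrite !gE//.
have wx0 : w - x != 0 by rewrite subr_eq0.
have -> : k.+1`!%:R * F k.+1 x - (k`!%:R * F k w - k`!%:R * F k x) / (w - x) =
    - (k`!%:R * (F k w - F k x - k.+1%:R * (w - x) * F k.+1 x) / (w - x)).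
  by rewrite factS natrM; field.
rewrite cnormN cnorm_div cnormM cnorm_nat ltr_pdivrMr ?cnorm_gt0//.
apply: (@le_lt_trans _ _ (k`!%:R * ((`|K k| + 1) * cnorm (w - x) ^+ 2))).
  apply: ler_wpM2l => //; apply: (le_trans (F_diff k Sx Sw)).
  by rewrite ler_wpM2r ?exprn_ge0 ?cnorm_ge0// (le_trans (ler_norm _))// lerDl.
rewrite expr2 !mulrA ltr_pM2r ?cnorm_gt0// mulrC -ltr_pdivlMr//.
by rewrite cnorm_dist.
Qed.

Lemma nderive_withinE k x : S x -> nderive_within S k f x = k`!%:R * F k x.
Proof.
elim: k x => [|k IH] x Sx; first by rewrite fact0 mul1r F0.
rewrite /nderive_within iterS -/(nderive_within S k f) /derive_within.
have FF := within_dnbhs_proper Sx.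
apply: (@cvg_lim R[i]); first exact: norm_hausdorff.
exact: difference_quotients_cvg.
Qed.

Lemma smooth_within_taylor : smooth_within S f.
Proof.
move=> k x Sx; apply/cvg_ex; exists (k.+1`!%:R * F k.+1 x).
by apply: difference_quotients_cvg => // z; apply: nderive_withinE.
Qed.

End DerivativesFromTaylor.

(** * Merging overlapping discs *)

Section PairwisePermutation.
Context {T : eqType} (e : rel T).

Lemma not_pairwise_split (s : seq T) : ~~ pairwise e s ->
  exists x y s', perm_eq s [:: x, y & s'] /\ ~~ e x y.
Proof.
elim: s => [//|x s IH] /=; rewrite negb_and => /orP[/allPn[y ys xy]|/IH].
  by exists x, y, (rem y s); rewrite perm_cons perm_to_rem.
move=> [x1 [y1 [s' [ss xy]]]]; exists x1, y1, (x :: s'); split=> //.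
apply: (@perm_trans _ [:: x, x1, y1 & s']); first by rewrite perm_cons.
by have := perm_catCA [:: x] [:: x1; y1] s'; move=> /= ->.
Qed.

Lemma pairwise_rem (s : seq T) x y : symmetric e -> pairwise e s ->
  x \in s -> y \in s -> (x == y) || e x y.
Proof.
move=> es; elim: s => [//|u s IH] /= /andP[/allP hu ps].
rewrite !inE => /orP[/eqP->|xs] /orP[/eqP->|ys]; rewrite ?eqxx//.
- by rewrite hu ?orbT.
- by rewrite es hu ?orbT.
- exact: IH.
Qed.

Lemma pairwise_all_rem (s : seq T) x : symmetric e -> pairwise e s ->
  x \in s -> all (e x) (rem x s).
Proof.
move=> es; elim: s => [//|u s IH] /= /andP[/allP hu ps]; rewrite inE eq_sym.
case: (eqVneq u x) => [<- _|ux /= xs]; first exact/allP.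
by rewrite es hu//= IH.
Qed.

End PairwisePermutation.

Section AvoidIntervals.
Context {R : realType}.

(* A point inside an interval is moved to its right end: each interval is used at
   most once. *)
Lemma avoid_intervals (l : seq (R * R)) (a : R) :
  (forall x, x \in l -> 0 <= x.2) ->
  exists t, [/\ a <= t, t <= a + 2 * \sum_(x <- l) x.2 &
    forall x, x \in l -> t <= x.1 - x.2 \/ x.1 + x.2 <= t].
Proof.
have [n] := ubnP (size l); elim: n l a => // n IH l a ln l0.
have s0 : 0 <= \sum_(x <- l) x.2 by rewrite big_seq sumr_ge0.
have [/hasP[x xl /andP[h1 h2]]|/hasPn h] :=
    boolP (has (fun x : R * R => (x.1 - x.2 < a) && (a < x.1 + x.2)) l).
  have [||t [h3 h4 h5]] := IH (rem x l) (x.1 + x.2).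
  - rewrite size_rem//; case: (l) ln xl => //.
  - by move=> y /mem_rem; apply: l0.
  exists t; split; first by apply: ltW; apply: lt_le_trans h3.
    rewrite (perm_big _ (perm_to_rem xl)) big_cons /=; lra.
  move=> y yl; have := perm_mem (perm_to_rem xl) y; rewrite yl inE.
  by move=> /esym/orP[/eqP ->|/h5//]; right.
exists a; split; [by []|lra|] => x /h; rewrite negb_and -!leNgt => /orP[?|?]; by [left|right].
Qed.

End AvoidIntervals.

Section PolynomialContinuity.
Context {R : realType}.
Implicit Types (p q : {poly R[i]}) (z w : R[i]).

Lemma poly_bounded p (r : R) : exists2 B : R, 0 < B &
  forall w, cnorm w <= r -> cnorm p.[w] <= B.
Proof.
elim/poly_ind: p => [|p c [B B0 IH]].
  by exists 1 => // w _; rewrite horner0 cnorm0.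
exists (B * (`|r| + 1) + cnorm c).
  by rewrite ltr_pwDl ?cnorm_ge0// mulr_gt0// ltr_wpDl.
move=> w wr; rewrite hornerMXaddC (le_trans (cnormD _ _))// lerD2r cnormM.
rewrite ler_pM ?cnorm_ge0 ?IH// (le_trans wr)//.
by rewrite (le_trans (ler_norm _))// lerDl.
Qed.

Lemma poly_continuous p z (e : R) : 0 < e -> exists2 d : R, 0 < d &
  forall w, cnorm (z - w) < d -> cnorm (p.[w] - p.[z]) < e.
Proof.
move=> e0; have /factor_theorem[p1 pE] : root (p - p.[z]%:P) z.
  by rewrite /root !hornerE subrr.
have [B B0 hB] := poly_bounded p1 (cnorm z + 1).
exists (Num.min 1 (e / B)); first by rewrite lt_min ltr01 divr_gt0.
move=> w; rewrite lt_min => /andP[h1 h2].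
have -> : p.[w] - p.[z] = p1.[w] * (w - z).
  by have := congr1 (horner^~ w) pE; rewrite !hornerE.
rewrite cnormM (le_lt_trans (y := B * cnorm (z - w)))//.
  rewrite cnorm_dist ler_wpM2r ?cnorm_ge0// hB//.
  have := cnorm_tri w 0 z; rewrite !subr0 cnorm_dist; lra.
by rewrite mulrC -ltr_pdivlMr.
Qed.

Lemma open_poly_lt p q (B : R) : 0 < B ->
  open [set z | cnorm p.[z] < B * cnorm q.[z]].
Proof.
move=> B0; rewrite openE => z /= h; apply/nbhs_cnormP.
pose e := (B * cnorm q.[z] - cnorm p.[z]) / 2.
have e0 : 0 < e by rewrite divr_gt0// subr_gt0.
have [d1 d10 h1] := poly_continuous p z e0.
have [|d2 d20 h2] := @poly_continuous q z (e / B); first exact: divr_gt0.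
exists (Num.min d1 d2); first by rewrite lt_min d10.
move=> w; rewrite lt_min => /andP[/h1 k1 /h2 k2] /=.
have k3 := cnorm_subl p.[w] p.[z].
have k4 := cnorm_subl q.[z] q.[w].
move: k2; rewrite cnorm_dist ltr_pdivlMr// => k2.
have k5 : B * cnorm q.[z] <= B * cnorm q.[w] + B * cnorm (q.[z] - q.[w]).
  by rewrite -mulrDr ler_wpM2l ?(ltW B0)//; lra.
rewrite /e in k1 k2; lra.
Qed.

Lemma open_cnorm_gt c (r : R) : open [set z : R[i] | r < cnorm (z - c)].
Proof.
rewrite openE => z /= h; apply/nbhs_cnormP.
exists (cnorm (z - c) - r); first by rewrite subr_gt0.
move=> w zw /=; have := cnorm_tri z c w; lra.
Qed.

Lemma open_cnorm_lt c (r : R) : open [set z : R[i] | cnorm (z - c) < r].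
Proof.
rewrite openE => z /= h; apply/nbhs_cnormP.
exists (r - cnorm (z - c)); first by rewrite subr_gt0.
move=> w zw /=; have := cnorm_tri w c z; rewrite (cnorm_dist w z); lra.
Qed.

(** The square [-1, 1]^2 has compact image in [R[i]], and the disc is a closed part of this
    image. *)
Lemma compact_unit_disc : compact [set z : R[i] | cnorm z <= 1].
Proof.
have sqc : compact ((fun xy : R * R => xy.1 +i* xy.2) @`
    (`[-1, 1]%classic `*` `[-1, 1]%classic)).
  apply: continuous_compact; last by apply: compact_setX; exact: segment_compact.
  apply: continuous_subspaceT => -[x y] A /nbhs_cnormP[d d0 h].
  have d20 : 0 < d / 2 by rewrite divr_gt0.
  exists (ball x (d / 2), ball y (d / 2)) => /=.
    by split; apply: nbhsx_ballx.
  move=> [u v] [/= xu yv]; apply: h; apply: le_lt_trans (cnorm_le_ReIm _) _ => /=.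
  by rewrite [d]splitr ltrD.
have -> : [set z : R[i] | cnorm z <= 1] = ((fun xy : R * R => xy.1 +i* xy.2) @`
    (`[-1, 1]%classic `*` `[-1, 1]%classic)) `&` ~` [set z | 1 < cnorm (z - 0)].
  apply/seteqP; split=> [z /= z1|z /= [_]]; last by rewrite subr0 => /negP; rewrite -leNgt.
  split; last by rewrite subr0; apply/negP; rewrite -leNgt.
  exists (complex.Re z, complex.Im z); last by case: (z).
  have hr := le_trans (cnorm_Re z) z1; have hi := le_trans (cnorm_Im z) z1.
  by split; rewrite /= in_itv /=; rewrite -ler_norml.
by apply: compact_closedI => //; apply: open_closedC; apply: open_cnorm_gt.
Qed.

End PolynomialContinuity.

Section MergingDiscs.
Context {R : realType}.
Variables (c : nat -> R[i]) (r : nat -> R).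
Hypothesis r_gt0 : forall n, 0 < r n.
Local Notation blob := (R[i] * seq nat)%type.
Implicit Types (b : blob) (bs : seq blob).

(** A blob is a centre with the indices of the discs merged into it. Keeping the indices, and not
    only the radius, lets sums over blobs be redistributed over the original discs. *)
Definition blob_radius b : R := \sum_(n <- b.2) r n.

Definition blob_covers b := b.2 != [::] /\
  forall n, n \in b.2 -> cnorm (b.1 - c n) + r n <= blob_radius b.

(** External tangency is allowed: the open discs are disjoint, but their circles may touch. *)
Definition blob_disjoint b1 b2 :=
  blob_radius b1 + blob_radius b2 <= cnorm (b1.1 - b2.1).

Lemma blob_disjoint_sym : symmetric blob_disjoint.
Proof. by move=> b1 b2; rewrite /blob_disjoint addrC cnorm_dist. Qed.

Lemma blob_radius_gt0 b : b.2 != [::] -> 0 < blob_radius b.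
Proof.
rewrite /blob_radius; case: b => z [//|n s] _ /=.
by rewrite big_cons ltr_pwDl// sumr_ge0// => k _; apply: ltW.
Qed.

(** The centres being less than R1 + R2 apart, some point between them is within R2 of the first and
    within R1 of the second; the disc of radius R1 + R2 around it contains both. *)
Lemma merge_two b1 b2 : blob_covers b1 -> blob_covers b2 -> ~~ blob_disjoint b1 b2 ->
  exists2 b, blob_covers b & b.2 = b1.2 ++ b2.2.
Proof.
move=> [n1 h1] [n2 h2]; rewrite /blob_disjoint -ltNge => lt12.
have r1 := blob_radius_gt0 n1; have r2 := blob_radius_gt0 n2.
set R1 := blob_radius b1 in h1 lt12 r1; set R2 := blob_radius b2 in h2 lt12 r2.
have R12 : 0 < R1 + R2 by rewrite addr_gt0.
pose t := R2 / (R1 + R2).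
have t0 : 0 <= t by rewrite divr_ge0// ltW.
have t1 : 1 - t = R1 / (R1 + R2) by rewrite /t; field; rewrite gt_eqF.
have t1' : 0 <= 1 - t by rewrite t1 divr_ge0// ltW.
pose z := b1.1 + t%:C * (b2.1 - b1.1).
have z1 : cnorm (z - b1.1) <= R2.
  rewrite /z addrC addKr cnormM cnorm_realp// cnorm_dist.
  by rewrite /t mulrAC ler_pdivrMr// ler_wpM2l// ltW.
have z2 : cnorm (z - b2.1) <= R1.
  have -> : z - b2.1 = (1 - t)%:C * (b1.1 - b2.1).
    by rewrite /z rmorphB rmorph1; ring.
  rewrite cnormM cnorm_realp// t1.
  by rewrite mulrAC ler_pdivrMr// ler_wpM2l// ltW.
exists (z, b1.2 ++ b2.2) => //; split.
  by case: (b1.2) n1.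
rewrite /blob_radius /= big_cat /= -/(blob_radius b1) -/(blob_radius b2) -/R1 -/R2.
move=> n; rewrite mem_cat => /orP[/h1|/h2] h.
  have := cnorm_tri z (c n) b1.1; lra.
have := cnorm_tri z (c n) b2.1; lra.
Qed.

(** Every merge removes one blob and keeps the multiset of indices, so the process stops, with the
    same total radius. *)
Lemma merge_blobs bs : (forall b, b \in bs -> blob_covers b) ->
  exists bs', [/\ forall b, b \in bs' -> blob_covers b,
    perm_eq (flatten (map snd bs')) (flatten (map snd bs)) &
    pairwise blob_disjoint bs'].
Proof.
have [n] := ubnP (size bs); elim: n bs => // n IH bs bsn hbs.
have [|/not_pairwise_split[b1 [b2 [bs0 [pbs b12]]]]] := boolP (pairwise blob_disjoint bs).
  by exists bs.
have mb b : b \in [:: b1, b2 & bs0] -> blob_covers b.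
  by rewrite -(perm_mem pbs); apply: hbs.
have [|||b hb bE] := @merge_two b1 b2 => //.
- by apply: mb; rewrite !inE eqxx.
- by apply: mb; rewrite !inE eqxx orbT.
have [||bs' [h1 h2 h3]] := IH (b :: bs0).
- by move: bsn; rewrite (perm_size pbs).
- by move=> b'; rewrite inE => /orP[/eqP->//|h]; apply: mb; rewrite !inE h !orbT.
exists bs'; split=> //; apply: (perm_trans h2).
by rewrite /= bE -catA perm_sym; apply: (perm_flatten (perm_map snd pbs)).
Qed.

Lemma merge_discs (s : seq nat) : exists bs,
  [/\ forall b, b \in bs -> blob_covers b, perm_eq (flatten (map snd bs)) s &
    pairwise blob_disjoint bs].
Proof.
have [|bs [h1 h2 h3]] := @merge_blobs [seq (c n, [:: n]) | n <- s].
  move=> b /mapP[n _ ->]; split=> // k; rewrite /blob_radius /= inE => /eqP->.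
  by rewrite subrr cnorm0 add0r big_seq1.
exists bs; split=> //; apply: (perm_trans h2).
by rewrite -map_comp (eq_map (g := fun n => [:: n]))// flatten_seq1.
Qed.

End MergingDiscs.

(** * The Cauchy cycle bounding the merged discs *)

Section CauchySystemOfDiscs.
Context {R : realType}.
Local Notation circle := (R[i] * R[i] * R)%type.
Variables (c : nat -> R[i]) (r : nat -> R) (lev : nat -> nat) (d : nat -> R).
Variables (I : set R[i]) (M : nat -> R).
Hypothesis r_gt0 : forall n, 0 < r n.
Hypothesis d_gt0 : forall m, 0 < d m.
Hypothesis d0_le : d 0%N <= 2^-1.
Hypothesis d_decr : forall m n, (m <= n)%N -> d n <= d m.
Hypothesis I0 : I 0.
Hypothesis I_half : forall z, I z -> cnorm z <= 2^-1.
Hypothesis disc_far : forall n z, I z -> d (lev n) + r n <= cnorm (z - c n).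
Hypothesis r_sum : forall s m, uniq s -> (forall n, n \in s -> (m <= lev n)%N) ->
  \sum_(n <- s) r n <= d m / 8.
Hypothesis r_moment : forall s k, uniq s ->
  \sum_(n <- s) r n * (2 / d (lev n)) ^+ k.+1 <= M k.

Local Notation X := ([set z : R[i] | `|z| <= 1] `\` \bigcup_n ball (c n) (r n)%:C).

(** The points of the closed unit disc where |p| >= B |q| form a compact set that misses X, hence
    lies in the union of the deleted open discs. *)
Lemma bad_set_cover (p q : {poly R[i]}) (B : R) : 0 < B ->
  (forall z, X z -> cnorm p.[z] < B * cnorm q.[z]) ->
  exists2 s : seq nat, uniq s & forall z, cnorm z <= 1 ->
    B * cnorm q.[z] <= cnorm p.[z] -> exists2 n, n \in s & cnorm (z - c n) < r n.
Proof.
move=> B0 pq.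
pose K := [set z : R[i] | cnorm z <= 1] `&` ~` [set z | cnorm p.[z] < B * cnorm q.[z]].
have cK : compact K.
  apply: compact_closedI; first exact: compact_unit_disc.
  by apply: open_closedC; apply: open_poly_lt.
have cov : cover_compact K by rewrite -compact_cover.
have [||D _ DK] := cov nat setT (fun n => [set z | cnorm (z - c n) < r n]).
- by move=> n _; exact: open_cnorm_lt.
- move=> z [/= z1 hz]; apply: contrapT => hn; apply: hz; apply: pq; split=> /=.
    by rewrite cnormE lecR.
  move=> [n _ /ball_cnorm]; rewrite cnorm_dist => zn; apply: hn.
  by exists n.
exists (finmap.enum_fset D) => [|z z1 hz]; first exact: finmap.fset_uniq.
have [|n /= nD zn] := DK z; last by exists n.
by split=> //=; apply/negP; rewrite -leNgt.
Qed.

(** As an infimum it depends on the circle alone, as [adapted_cycle] requires, and not on a blob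
    behind it. *)
Definition circle_dist (x : circle) : R :=
  inf [set t | exists w z, [/\ on_circle x w, I z & t = cnorm (w - z)]].

Lemma circle_dist_le (x : circle) w z : on_circle x w -> I z ->
  circle_dist x <= cnorm (w - z).
Proof.
move=> xw Iz; apply: ge_inf; last by exists w, z.
by exists 0 => _ [u [v [_ _ ->]]]; apply: cnorm_ge0.
Qed.

Lemma le_circle_dist (x : circle) (e : R) : 0 <= radius x ->
  (forall w z, on_circle x w -> I z -> e <= cnorm (w - z)) -> e <= circle_dist x.
Proof.
move=> x0 h; apply: lb_le_inf => [|_ [w [z [xw Iz ->]]]]; last exact: h.
exists (cnorm (centre x + (radius x)%:C - 0)), (centre x + (radius x)%:C), 0.
by split=> //; rewrite /on_circle addrC addKr cnorm_realp.
Qed.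

Local Notation brad := (blob_radius r).

(** The disc of least level m decides: all levels in the blob being at least m, its radius is at
    most d_m / 8, so it stays near a disc at distance at least d_m from [I]. Merging thus costs only
    a factor 2 in the distance. *)
Lemma blob_far b : blob_covers c r b -> uniq b.2 ->
  exists e, [/\ 0 < e, (forall n, n \in b.2 -> d (lev n) <= 2 * e),
    (forall z, I z -> brad b < cnorm (z - b.1)) &
    (forall w z, cnorm (w - b.1) = brad b -> I z -> e <= cnorm (w - z))].
Proof.
move=> [b0 hb] ub.
have [n0 [n0b hmin]] : exists n0, n0 \in b.2 /\ forall n, n \in b.2 -> (lev n0 <= lev n)%N.
  case: (b.2) b0 => [//|a s] _.
  have := @arg_minnP 'I_(size (a :: s)) ord0 predT
    (fun i => lev (nth 0%N (a :: s) i)) isT.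
  case=> i _ hi; exists (nth 0%N (a :: s) i); split; first exact: mem_nth.
  move=> n ns; have ln : (index n (a :: s) < size (a :: s))%N by rewrite index_mem.
  by have := hi (Ordinal ln) isT; rewrite /= nth_index.
have bd : brad b <= d (lev n0) / 8 by apply: r_sum.
have dn0 := d_gt0 (lev n0).
have key z : I z -> d (lev n0) + 2 * r n0 - brad b <= cnorm (z - b.1).
  move=> Iz; have h1 := disc_far n0 Iz; have h2 := hb _ n0b.
  have := cnorm_tri z (c n0) b.1; lra.
have rn0 := r_gt0 n0.
exists (d (lev n0) / 2); split.
- by rewrite divr_gt0.
- by move=> n nb; have := d_decr (hmin _ nb); lra.
- by move=> z /key; lra.
move=> w z wb /key; have := cnorm_tri z b.1 w; rewrite (cnorm_dist z w); lra.
Qed.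

Lemma cauchy_system_discs : cauchy_system X I (fun k => 4 ^+ k.+1 + M k).
Proof.
move=> p q B B0 pq.
have [s us hs] := bad_set_cover B0 pq.
have [bs [bcov bs_s bdis]] := merge_discs c r_gt0 s.
have buniq b : b \in bs -> uniq b.2.
  move=> bbs; have : uniq (flatten (map snd bs)) by rewrite (perm_uniq bs_s).
  elim: (bs) bbs => [//|b' t IH]; rewrite inE /= cat_uniq.
  by move=> /orP[/eqP->/and3P[]//|/IH h /and3P[_ _ /h]].
have inblob z : cnorm z <= 1 -> B * cnorm q.[z] <= cnorm p.[z] ->
    exists2 b, b \in bs & cnorm (z - b.1) < brad b.
  move=> z1 /(hs _ z1)[n ns zn].
  have /flattenP[t /mapP[b bbs ->] nb] : n \in flatten (map snd bs).
    by rewrite (perm_mem bs_s).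
  exists b => //; have [_ /(_ _ nb)] := bcov _ bbs.
  have := cnorm_tri z b.1 (c n); rewrite (cnorm_dist b.1); lra.
have dis b1 b2 w : b1 \in bs -> b2 \in bs -> b1 != b2 ->
    cnorm (w - b1.1) <= brad b1 -> brad b2 <= cnorm (w - b2.1).
  move=> h1 h2 h12 hw.
  have := pairwise_rem (@blob_disjoint_sym _ r) bdis h1 h2.
  rewrite (negPf h12) /= /blob_disjoint.
  have := cnorm_tri b1.1 b2.1 w; rewrite (cnorm_dist b1.1 w); lra.
have dis' b1 b2 w : b1 \in bs -> b2 \in bs -> b1 != b2 ->
    cnorm (w - b1.1) < brad b1 -> brad b2 < cnorm (w - b2.1).
  move=> h1 h2 h12 hw.
  have := pairwise_rem (@blob_disjoint_sym _ r) bdis h1 h2.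
  rewrite (negPf h12) /= /blob_disjoint.
  have := cnorm_tri b1.1 b2.1 w; rewrite (cnorm_dist b1.1 w); lra.
have bpos b : b \in bs -> 0 < brad b by move=> /bcov[/(blob_radius_gt0 r_gt0)].
have bsum : \sum_(b <- bs) brad b <= 16^-1.
  have -> : \sum_(b <- bs) brad b = \sum_(n <- s) r n.
    rewrite -(perm_big _ bs_s) big_flatten /= big_map.
    by apply: eq_bigr.
  by apply: (le_trans (r_sum us (m := 0%N) _)) => //; move: d0_le; lra.
(* Blobs may cross the unit circle, so the outer contour has a radius t between 3/4 and 3/4 + 2/16 =
   7/8 chosen to cut no blob; [I] stays at distance at least 1/4 from it. *)
have [|t [t1 t2 tb]] := @avoid_intervals _ [seq (cnorm b.1, brad b) | b <- bs] (3 / 4).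
  by move=> _ /mapP[b bbs ->] /=; apply/ltW/bpos.
rewrite big_map /= in t2.
have {}tb b : b \in bs -> t <= cnorm b.1 - brad b \/ cnorm b.1 + brad b <= t.
  by move=> bbs; apply: (tb (cnorm b.1, brad b)); apply: map_f.
have t78 : t <= 7 / 8 by lra.
pose inner b := cnorm b.1 + brad b <= t.
pose outer_circle : circle := (1, 0, t).
pose bcircle b : circle := (-1, b.1, brad b).
pose cs := outer_circle :: [seq bcircle b | b <- bs & inner b].
have csP x : x \in cs -> x = outer_circle \/ exists b, [/\ b \in bs, inner b & x = bcircle b].
  rewrite inE => /orP[/eqP->|/mapP[b]]; [by left|rewrite mem_filter => /andP[h1 h2 ->]].
  by right; exists b.
(* A point of the cycle violating the bound would lie inside a blob, but the outer circle cuts none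
   and the blobs are disjoint. *)
have good x w : x \in cs -> on_circle x w -> cnorm p.[w] < B * cnorm q.[w].
  move=> /csP[->|[b [bbs ib ->]]]; rewrite /on_circle /centre /radius /= => xw;
    rewrite ltNge; apply/negP => hw.
    rewrite subr0 in xw; have [|b bbs wb] := inblob w _ hw; first lra.
    have h1 := cnorm_subl w b.1; have h2 := cnorm_subl b.1 w.
    by rewrite cnorm_dist in h2; case: (tb b bbs); lra.
  have [|b' b'bs wb'] := inblob w _ hw.
    have := cnorm_tri w 0 b.1; rewrite !subr0; move: ib; rewrite /inner; lra.
  have [eqb|neqb] := eqVneq b b'; first by move: wb'; rewrite -eqb xw ltxx.
  by have := dis _ _ w bbs b'bs neqb; rewrite xw lexx => /(_ isT); rewrite leNgt wb'.
have windE a : winding cs a = (cnorm a < t)%R%:R -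
    \sum_(b <- bs | inner b) (cnorm (a - b.1) < brad b)%R%:R.
  rewrite /winding big_cons big_map big_filter /weight /centre /radius /= subr0 mul1r.
  by congr (_ + _); rewrite -sumrN; apply: eq_bigr => b _; rewrite mulN1r.
have offE a : cnorm a != t -> (forall b, b \in bs -> inner b -> cnorm (a - b.1) != brad b) ->
    off_circles cs a.
  move=> at_ ab x /csP[->|[b [bbs ib ->]]]; rewrite /centre /radius /= ?subr0//.
  exact: ab.
have far b : b \in bs -> exists e, [/\ 0 < e, (forall n, n \in b.2 -> d (lev n) <= 2 * e),
    (forall z, I z -> brad b < cnorm (z - b.1)) &
    (forall w z, cnorm (w - b.1) = brad b -> I z -> e <= cnorm (w - z))].
  by move=> bbs; apply: blob_far; [exact: bcov|exact: buniq].
have cs0 : positive_radii cs.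
  move=> x /csP[->|[b [bbs _ ->]]]; rewrite /radius /=; first lra.
  exact: bpos.
exists cs, circle_dist; split=> //.
- by move=> x /csP[->|[b [_ _ ->]]]; rewrite /weight /= ?cnormN cnorm1.
- move=> a /eqP qa.
  have qa_bad : B * cnorm q.[a] <= cnorm p.[a] by rewrite qa cnorm0 mulr0 cnorm_ge0.
  (* A pole beyond the outer circle lies outside every circle of the cycle; a pole of modulus at
     most t lies in exactly one blob, an inner one, and there the weights 1 and -1 cancel. *)
  have outside : t < cnorm a -> off_circles cs a /\ winding cs a = 0.
    move=> ta; have h b : b \in bs -> inner b -> brad b < cnorm (a - b.1).
      by move=> bbs ib; have := cnorm_subl a b.1; move: ib; rewrite /inner; lra.
    split; first by apply: offE => [|b bbs ib]; rewrite gt_eqF ?h.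
    rewrite windE (lt_gtF ta) sub0r big_seq_cond big1 ?oppr0// => b /andP[bbs ib].
    by rewrite (lt_gtF (h b bbs ib)).
  have [/outside//|at_] := ltP t (cnorm a).
  have [|b0 b0s ab0] := inblob a _ qa_bad; first lra.
  have [hb|ib0] := tb _ b0s.
    exfalso; have := cnorm_subl b0.1 a; rewrite cnorm_dist; lra.
  have at' : cnorm a < t by have := cnorm_tri a 0 b0.1; rewrite !subr0; lra.
  have h b : b \in rem b0 bs -> brad b < cnorm (a - b.1).
    move=> bb; have /allP/(_ _ bb) := pairwise_all_rem (@blob_disjoint_sym _ r) bdis b0s.
    rewrite /blob_disjoint; have := cnorm_tri b0.1 b.1 a; rewrite (cnorm_dist b0.1 a); lra.
  split.
    apply: offE => [|b bbs ib]; first by rewrite lt_eqF.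
    have := perm_mem (perm_to_rem b0s) b; rewrite bbs inE => /esym/orP[/eqP->|/h hb].
      by rewrite lt_eqF.
    by rewrite gt_eqF.
  rewrite windE at' (perm_big _ (perm_to_rem b0s)) big_cons /inner ib0 ab0.
  rewrite big_seq_cond big1 => [|b /andP[bb _]]; first by rewrite /= addr0 subrr.
  by rewrite (lt_gtF (h b bb)).
- move=> z Iz; have zt : cnorm z < t by have := I_half Iz; lra.
  have h b : b \in bs -> brad b < cnorm (z - b.1) by move=> /far[e [_ _ hz _]]; exact: hz.
  split; first by apply: offE => [|b bbs ib]; rewrite ?(lt_eqF zt) ?(gt_eqF (h b bbs)).
  rewrite windE zt big_seq_cond big1 ?subr0// => b /andP[bb _].
  by rewrite (lt_gtF (h b bb)).
have dout : 4^-1 <= circle_dist outer_circle.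
  apply: le_circle_dist; first by rewrite /radius /=; lra.
  move=> w z; rewrite /on_circle /centre /radius /= subr0 => wt /I_half zh.
  by have := cnorm_subl w z; lra.
have din b e : b \in bs -> (forall w z, cnorm (w - b.1) = brad b -> I z -> e <= cnorm (w - z)) ->
    e <= circle_dist (bcircle b).
  by move=> bbs h; apply: le_circle_dist => //; rewrite /radius /= ltW// bpos.
split.
- by move=> x w xcs xw; apply/ltW/(good x).
- move=> x /csP[->|[b [bbs _ ->]]]; first by apply: lt_le_trans dout; lra.
  by have [e [e0 _ _ /(din _ _ bbs)]] := far _ bbs; apply: lt_le_trans.
- by move=> x w z _; apply: circle_dist_le.
(* The outer circle has radius at most 1 and distance at least 1/4 from [I]: it gives the term
   4^(k+1). *)
move=> k; rewrite big_cons big_map big_filter; apply: lerD.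
  rewrite /radius /= -[X in _ <= X]mul1r; apply: ler_pM => //.
  - lra.
  - by rewrite invr_ge0 exprn_ge0//; apply: le_trans dout; lra.
  - lra.
  rewrite -exprVn lerXn2r ?nnegrE ?invr_ge0//; first by apply: le_trans dout; lra.
  by rewrite -[4]invrK lef_pV2 ?posrE//; apply: lt_le_trans dout; lra.
(* The radius of a blob is the sum of the radii of its discs, and by [blob_far] its circle is at
   distance at least d (lev n) / 2 from [I] for each of its discs n. *)
apply: (@le_trans _ _ (\sum_(b <- bs) \sum_(n <- b.2) r n * (2 / d (lev n)) ^+ k.+1)).
  rewrite big_mkcond big_seq [X in _ <= X]big_seq; apply: ler_sum => b bbs.
  have t0 : 0 <= \sum_(n <- b.2) r n * (2 / d (lev n)) ^+ k.+1.
    by apply: sumr_ge0 => n _; rewrite mulr_ge0 ?(ltW (r_gt0 n))// exprn_ge0// divr_ge0// ltW.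
  case: ifP => // _; have [e [e0 hn _ /(din _ _ bbs) hd]] := far _ bbs.
  rewrite /radius /= /blob_radius mulr_suml big_seq [X in _ <= X]big_seq.
  apply: ler_sum => n nb; rewrite ler_wpM2l ?(ltW (r_gt0 n))//.
  rewrite -exprVn lerXn2r ?nnegrE ?divr_ge0 ?(ltW (d_gt0 _))//.
    by rewrite invr_ge0 (le_trans _ hd)// ltW.
  rewrite -[2 / _]invf_div lef_pV2 ?posrE ?divr_gt0//; last exact: lt_le_trans hd.
  by apply: le_trans hd; have := hn _ nb; lra.
have -> : \sum_(b <- bs) \sum_(n <- b.2) r n * (2 / d (lev n)) ^+ k.+1 =
    \sum_(n <- s) r n * (2 / d (lev n)) ^+ k.+1.
  by rewrite -(perm_big _ bs_s) big_flatten /= big_map.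
exact: r_moment.
Qed.

End CauchySystemOfDiscs.

(** * McKissick's lemma *)

Section TelescopingProducts.
Context {R : realType}.
Variables (Z : set R[i]) (h : nat -> R[i] -> R[i]) (t y K : nat -> R).
Hypothesis t0 : t 0%N = 2^-1.
Hypothesis t_incr : forall i j, (i <= j)%N -> t i <= t j.
Hypothesis t_le1 : forall j, t j <= 1.
Hypothesis y_ge0 : forall j, 0 <= y j.
Hypothesis K_ge0 : forall j, 0 <= K j.
Hypothesis h_le : forall j z, Z z -> cnorm (h j z) <= K j.
Hypothesis h_out : forall j z, Z z -> t j.+1 <= cnorm z -> cnorm (h j z) <= y j.
Hypothesis h_in : forall j z, Z z -> cnorm z <= t j -> cnorm (h j z - 1) <= y j.
Hypothesis yK : forall j, y j * (K j.+1 + 1) <= 2^-1 ^+ j.+1.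
Hypothesis yK0 : forall j, (K 0%N + 1) * y j <= 2^-1 ^+ j.+3.

Local Notation g n z := (\prod_(j < n) h j z).

Let y_small j : y j <= 2^-1 ^+ j.+3.
Proof. by apply: le_trans (yK0 j); rewrite ler_peMl// lerDr. Qed.

Let half_le1 n : 2^-1 ^+ n <= 1 :> R.
Proof. by rewrite exprn_ile1//; lra. Qed.

Let y_le1 j : y j <= 1.
Proof. exact: le_trans (y_small j) (half_le1 _). Qed.

Lemma prod_le1 n (a : nat -> R) : (forall i, (i < n)%N -> 0 <= a i <= 1) ->
  \prod_(i < n) a i <= 1.
Proof.
elim: n => [|n IH] ha; first by rewrite big_ord0.
rewrite big_ord_recr /= -[X in _ <= X]mul1r; have /andP[a0 a1] := ha n (ltnSn n).
by apply: ler_pM => //; [apply: prodr_ge0 => i _; have /andP[] := ha i (ltnW (ltn_ord i))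
  |apply: IH => i ni; apply: ha; apply: ltnW].
Qed.

Lemma product_out n z : Z z -> t n.+1 <= cnorm z -> cnorm (g n.+1 z) <= y n.
Proof.
move=> Zz tz; rewrite big_ord_recr /= cnormM -[y n]mul1r ler_pM ?cnorm_ge0 ?h_out//.
rewrite cnorm_prod; apply: (prod_le1 (a := fun i => cnorm (h i z))) => i ni.
rewrite cnorm_ge0; apply: le_trans (y_le1 i); apply: h_out => //.
by apply: le_trans tz; apply: t_incr; rewrite ltnS ltnW.
Qed.

(** A new factor h changes the product g by g (h - 1). Inside radius t_(n+1) the factor is close to
    1 ([yK0]); outside, g is already so small that it beats the size of h ([yK]). The subtracted
    2^-n is room for the changes still to come. *)
Lemma product_bound n z : Z z ->
  cnorm (g n.+1 z) <= K 0%N + 1 - 2^-1 ^+ n /\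
  cnorm (g n.+2 z - g n.+1 z) <= 2^-1 ^+ n.+1.
Proof.
move=> Zz.
have step m : cnorm (g m.+1 z) <= K 0%N + 1 - 2^-1 ^+ m ->
    cnorm (g m.+2 z - g m.+1 z) <= 2^-1 ^+ m.+1.
  move=> hm; rewrite [g m.+2 z]big_ord_recr /= -[X in _ * _ - X]mulr1 -mulrBr cnormM.
  have [zt|tz] := leP (cnorm z) (t m.+1).
    apply: (@le_trans _ _ ((K 0%N + 1) * y m.+1)).
      rewrite ler_pM ?cnorm_ge0 ?h_in// (le_trans hm)// gerBl exprn_ge0//.
    apply: (le_trans (yK0 _)); rewrite [in X in X <= _]exprS [in X in X <= _]exprS.
    rewrite !exprS; have : 0 <= 2^-1 ^+ m :> R by rewrite exprn_ge0.
    lra.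
  apply: le_trans (yK m); rewrite ler_pM ?cnorm_ge0 ?product_out ?(ltW tz)//.
  by rewrite (le_trans (cnormB _ _))// cnorm1 lerD2r h_le.
elim: n => [|n [IH1 IH2]].
  have h0 : cnorm (g 1 z) <= K 0%N + 1 - 2^-1 ^+ 0.
    by rewrite big_ord1 expr0 addrK h_le.
  by split=> //; apply: step.
have h1 : cnorm (g n.+2 z) <= K 0%N + 1 - 2^-1 ^+ n.+1.
  rewrite -[X in cnorm X](subrK (g n.+1 z)) (le_trans (cnormD _ _))//.
  move: IH1 IH2; rewrite exprS; lra.
by split=> //; apply: step.
Qed.

Lemma product_dist n k z : Z z -> cnorm (g n.+1 z - g (n + k).+1 z) <= 2^-1 ^+ n.
Proof.
move=> Zz; suff : cnorm (g n.+1 z - g (n + k).+1 z) <= 2^-1 ^+ n - 2^-1 ^+ (n + k).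
  by move=> H; apply: (le_trans H); rewrite gerBl exprn_ge0.
elim: k => [|k IH]; first by rewrite addn0 !subrr cnorm0.
rewrite addnS (le_trans (cnorm_tri _ _ (g (n + k).+1 z)))//.
have [_] := product_bound (n + k) Zz; rewrite (cnorm_dist (\prod_(j < (n + k).+2) _)).
move: IH; rewrite [in 2^-1 ^+ (n + k).+1]exprS; lra.
Qed.

(** On the half disc the factors approach 1 geometrically; the bound stays below 1/2 and keeps the
    limit away from 0. *)
Lemma product_near1 n z : Z z -> cnorm z <= 2^-1 ->
  cnorm (g n z - 1) <= 2^-1 * (1 - 2^-1 ^+ n).
Proof.
move=> Zz zh; elim: n => [|n IH]; first by rewrite big_ord0 subrr cnorm0 expr0 subrr mulr0.
rewrite big_ord_recr /=.
rewrite (_ : _ * _ - 1 = (g n z - 1) + g n z * (h n z - 1)); last by ring.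
rewrite (le_trans (cnormD _ _))// cnormM.
have h1 : cnorm (h n z - 1) <= 2^-1 ^+ n.+3.
  apply: le_trans (y_small n); apply: h_in => //.
  by rewrite (le_trans zh)// -t0 t_incr.
have h2 : cnorm (g n z) <= 3 / 2.
  have := cnormD (g n z - 1) 1; rewrite subrK cnorm1.
  have : 0 <= 2^-1 ^+ n :> R by rewrite exprn_ge0.
  lra.
have h3 : cnorm (g n z) * cnorm (h n z - 1) <= 3 / 2 * 2^-1 ^+ n.+3.
  by rewrite ler_pM ?cnorm_ge0.
move: IH h3; rewrite !exprS; have : 0 <= 2^-1 ^+ n :> R by rewrite exprn_ge0.
lra.
Qed.

(** The partial products form a uniform Cauchy sequence. All t_n being at most 1, the product of n +
    1 factors is at most y_n beyond radius 1, so the limit vanishes there. *)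
Lemma product_limit : exists G : R[i] -> R[i],
  [/\ forall z, Z z -> 1 <= cnorm z -> G z = 0,
      forall z, Z z -> cnorm z <= 2^-1 -> G z != 0 &
      forall e : R, 0 < e -> exists n, forall z, Z z -> cnorm (G z - g n z) < e].
Proof.
have small e : 0 < e -> exists n, 2^-1 ^+ n < e :> R.
  move=> e0; have /cvgr0Pnorm_lt/(_ _ e0)[N _ hN] : (fun n => 2^-1 ^+ n : R) @ \oo --> 0.
    by apply: cvg_expr; rewrite ger0_norm//; lra.
  by exists N; have := hN N (leqnn N); rewrite ger0_norm// exprn_ge0.
have ex z : Z z -> exists v, clim (fun n => g n.+1 z) v.
  move=> Zz; apply: complex_cauchy => e /small[N hN]; exists N => m Nm.
  by rewrite -(subnKC Nm) (le_lt_trans (product_dist _ _ Zz)).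
pose G z := xget 0 [set v | clim (fun n => g n.+1 z) v].
have GP z : Z z -> clim (fun n => g n.+1 z) (G z).
  by move=> /ex/(xgetPex 0).
have Gd n z : Z z -> cnorm (G z - g n.+1 z) <= 2^-1 ^+ n.
  move=> Zz; apply/ler_addgt0Pr => e e0.
  have /climP/(_ _ e0)[N _ hN] := GP z Zz.
  have := hN (n + N)%N (leq_addl _ _); have := product_dist n N Zz.
  have := cnorm_tri (G z) (g n.+1 z) (g (n + N).+1 z).
  rewrite (cnorm_dist (G z) (g (n + N).+1 z)) (cnorm_dist (g n.+1 z)); lra.
exists G; split.
- move=> z Zz z1; apply/eqP; rewrite -cnorm_eq0 eq_le cnorm_ge0 andbT.
  apply/ler_addgt0Pr => e e0; rewrite add0r.
  have [|n hn] := small (e / 2); first by rewrite divr_gt0.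
  have h1 : cnorm (g n.+1 z) <= 2^-1 ^+ n.
    apply: (le_trans (product_out Zz _)); first exact: le_trans (t_le1 _) z1.
    apply: (le_trans (y_small n)); rewrite !exprS.
    have : 0 <= 2^-1 ^+ n :> R by rewrite exprn_ge0.
    lra.
  have := Gd n z Zz; have := cnormD (G z - g n.+1 z) (g n.+1 z); rewrite subrK; lra.
- move=> z Zz zh; apply/negP => /eqP G0.
  (* |G - g_3| <= 1/4 and |g_3 - 1| <= 7/16 add up to less than 1. *)
  have := Gd 2%N z Zz; have := product_near1 3 Zz zh; rewrite G0 sub0r cnormN.
  have := cnormD (1 - g 3 z) (g 3 z); rewrite subrK cnorm1 cnorm_dist.
  rewrite !exprS expr0; lra.
move=> e /small[n hn]; exists n.+1 => z Zz.
exact: le_lt_trans (Gd n z Zz) hn.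
Qed.

End TelescopingProducts.

Section RootFactor.
Context {R : realType}.

(* Logarithmic derivative of w^N - 1: the sum of the 1 / (w - omega^i) has modulus
   at most N / e. *)
Lemma unity_root_dist n (w : R[i]) (e : R) : 0 < e <= 1 ->
  (forall i, (i < n.+1)%N -> e <= cnorm (w - omega n ^+ i)) -> e / 2 <= cnorm (1 - w ^+ n.+1).
Proof.
move=> /andP[e0 e1] hw; have [w2|w2] := leP (cnorm (w ^+ n.+1)) 2^-1.
  by have := cnorm_subl 1 (w ^+ n.+1); rewrite cnorm1; lra.
have w1 : w ^+ n.+1 != 1.
  apply/eqP => /(prim_rootP (omegaP n))[i wE].
  by have := hw i (ltn_ord i); rewrite wE subrr cnorm0 leNgt e0.
have w10 : 0 < cnorm (w ^+ n.+1 - 1) by rewrite cnorm_gt0 subr_eq0.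
have wn : 2^-1 <= cnorm (w ^+ n).
  have [h|h] := leP 1 (cnorm w).
    by rewrite cnormX (@le_trans _ _ 1)//; [lra|exact: exprn_ege1].
  apply: ltW; apply: (lt_le_trans w2); rewrite exprS cnormM.
  by rewrite ler_piMl ?cnorm_ge0// ltW.
have := congr1 cnorm (sum_inv_omega w1); rewrite cnorm_div cnormM cnorm_nat => hE.
have : n.+1%:R * cnorm (w ^+ n) / cnorm (w ^+ n.+1 - 1) <= n.+1%:R / e.
  rewrite -hE (le_trans (cnorm_sum _ _ _))//.
  rewrite mulr_natl -[n.+1 in X in _ <= X]card_ord -sumr_const ler_sum// => i _.
  by rewrite cnormV lef_pV2 ?posrE ?(lt_le_trans e0) ?hw.
rewrite -mulrA ler_pM2l ?ltr0n// ler_pdivrMr// mulrC ler_pdivlMr// => h.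
rewrite (cnorm_dist 1); apply: le_trans h; rewrite mulrC.
by rewrite ler_wpM2r// ltW.
Qed.

Lemma bernoulli (x : R) n : 0 <= x -> 1 + n%:R * x <= (1 + x) ^+ n.
Proof.
move=> x0; elim: n => [|n IH]; first by rewrite mul0r addr0 expr0.
rewrite exprS (@le_trans _ _ ((1 + x) * (1 + n%:R * x)))//.
  rewrite -natr1; have : 0 <= n%:R * x * x by rewrite !mulr_ge0.
  lra.
by rewrite ler_wpM2l//; lra.
Qed.

(** By Bernoulli, (1 + 2^-k)^(2^k) >= 2: a relative gap 2^-k between radii becomes a factor 2^L at
    the power 2^k L. *)
Lemma two_pow_le k L (x : R) : 1 + 2^-1 ^+ k <= x -> 2 ^+ L <= x ^+ (2 ^ k * L).
Proof.
move=> hx; rewrite exprM lerXn2r ?nnegrE ?exprn_ge0//.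
  by apply: le_trans hx; rewrite addr_ge0// exprn_ge0.
have h0 : 0 <= 2^-1 ^+ k :> R by rewrite exprn_ge0.
apply: (@le_trans _ _ ((1 + 2^-1 ^+ k) ^+ (2 ^ k))).
  apply: le_trans (bernoulli _ h0); by rewrite natrX exprVn mulfV ?expf_neq0.
by rewrite lerXn2r ?nnegrE//; lra.
Qed.

End RootFactor.

(** * Koerner's rational factors and the discs around their poles *)

Section KoernerFactors.
Context {R : realType}.
Variables (C : nat) (e : R).
Hypothesis e01 : 0 < e <= 1.
Hypothesis C_gt0 : (0 < C)%N.
Hypothesis eC : 2 ^+ 25 * C%:R ^+ 2 <= e * 2 ^+ C.

(** Off an annulus the j-th factor is within 2 / 2^level of 0 or 1. The slope 8 beats the growth
    (2^j)^6 of the squared degrees; the offset [C] beats 1 / e. *)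
Local Definition koerner_level j := (8 * j + C)%N.
(** The poles have the radius of index 2j + 1, separated from those of index 2j and 2j + 2 by a
    ratio of at least 1 + 2^-(2j+3); [two_pow_le] turns this ratio into 2^level. *)
Local Definition koerner_degree j := (2 ^ (2 * j + 3) * koerner_level j)%N.
Local Definition koerner_radius i : R := 1 - 2^-1 ^+ i.+1.
Local Definition koerner_stage j : seq R[i] :=
  [seq (koerner_radius (2 * j).+1)%:C * omega (koerner_degree j).-1 ^+ i | i <- iota 0
    (koerner_degree j)].
Local Definition koerner_centres J := flatten [seq koerner_stage j | j <- iota 0 J].
(** Every stage has a pole, so [l.+1] stages contain an [l]-th one and the default 0 is not
    reached. *)
Local Definition disc_centre l := nth 0 (koerner_centres l.+1) l.
(* Polynomial decay in [l] keeps the bound on the j-th factor polynomial in its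
   degree, whereas the tails decay exponentially. *)
Local Definition disc_radius l : R := e / (l.+1%:R * l.+2%:R).
Local Definition outside_discs (z : R[i]) :=
  forall l, disc_radius l <= cnorm (z - disc_centre l).

Let deg_gt0 j : (0 < koerner_degree j)%N.
Proof. by rewrite muln_gt0 expn_gt0 /= /koerner_level addn_gt0 C_gt0 orbT. Qed.

Let half_ge0 n : 0 <= 2^-1 ^+ n :> R.
Proof. by rewrite exprn_ge0. Qed.

Let half_le1 n : 2^-1 ^+ n <= 1 :> R.
Proof. by rewrite exprn_ile1//; lra. Qed.

Let u_half i : 2^-1 <= koerner_radius i <= 1.
Proof. rewrite /koerner_radius exprS; have := half_ge0 i; have := half_le1 i; lra. Qed.

Let u_step i : koerner_radius i * (1 + 2^-1 ^+ i.+2) <= koerner_radius i.+1.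
Proof.
rewrite /koerner_radius (exprS _ i.+1); have := half_ge0 i.+1; set q := 2^-1 ^+ i.+1 => q0; nra.
Qed.

Lemma size_centresS j : size (koerner_centres j.+1) = (size (koerner_centres j) + koerner_degree
  j)%N.
Proof.
by rewrite /koerner_centres -addn1 iotaD map_cat flatten_cat size_cat /= cats0 size_map size_iota.
Qed.

Lemma size_centres_ge j : (j <= size (koerner_centres j))%N.
Proof. by elim: j => // j IH; rewrite size_centresS; have := deg_gt0 j; lia. Qed.

(** The degrees at least double from stage to stage. Hence an index in stage j is less than twice
    the degree N_j, and the radii there are at least of order e / N_j^2. *)
Lemma size_centres_le j : (size (koerner_centres j) <= koerner_degree j)%N.
Proof.
elim: j => // j IH; rewrite size_centresS.
have : (2 * koerner_degree j <= koerner_degree j.+1)%N; last by lia.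
rewrite /koerner_degree (_ : 2 * j.+1 + 3 = (2 * j + 3).+2)%N; last by lia.
rewrite !expnS -!mulnA leq_mul2l /= mulnCA leq_mul2l; apply/orP; right.
rewrite /koerner_level; lia.
Qed.

Lemma disc_centreE j i : (i < koerner_degree j)%N ->
  disc_centre (size (koerner_centres j) + i) = (koerner_radius (2 * j).+1)%:C * omega
    (koerner_degree j).-1 ^+ i.
Proof.
move=> ij; rewrite /disc_centre; set l := (_ + i)%N.
have jl : (j <= l)%N by rewrite (leq_trans (size_centres_ge j)) ?leq_addr.
have -> : koerner_centres l.+1 = koerner_centres j ++ (koerner_stage j ++ flatten [seq
  koerner_stage k | k <- iota j.+1 (l - j)]).
  by rewrite /koerner_centres -{1}(subnKC jl) -addnS iotaD map_cat flatten_cat.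
rewrite nth_cat /l ltnNge leq_addr /= addKn nth_cat size_map size_iota ij.
by rewrite (nth_map 0%N) ?size_iota// nth_iota.
Qed.

Lemma disc_centre_le l : cnorm (disc_centre l) <= 1.
Proof.
rewrite /disc_centre; have [ll|ll] := ltnP l (size (koerner_centres l.+1)); last first.
  by rewrite nth_default// cnorm0.
have /flattenP[s /mapP[j _ ->] /mapP[i _ ->]] := mem_nth 0 ll.
have := u_half (2 * j).+1 => /andP[h1 h2].
by rewrite cnormM cnorm_omega mulr1 cnorm_realp//; lra.
Qed.

Lemma disc_radius_ge j i : (i < koerner_degree j)%N ->
  e / (8 * (koerner_degree j)%:R ^+ 2) <= disc_radius (size (koerner_centres j) + i).
Proof.
move=> ij; have := size_centres_le j; have := deg_gt0 j.
move: (size _) => m d0 md; case/andP: e01 => e0 _.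
rewrite /disc_radius ler_pM2l// lef_pV2 ?posrE ?mulr_gt0 ?exprn_gt0 ?ltr0n//.
rewrite -natrM -natrX -natrM ler_nat.
apply: (@leq_trans ((2 * koerner_degree j) * (4 * koerner_degree j))); last by lia.
by apply: leq_mul; lia.
Qed.

Local Definition koerner_factor j (z : R[i]) := (1 - (z / (koerner_radius (2 * j).+1)%:C) ^+
  koerner_degree j)^-1.

Let u0 i : (koerner_radius i)%:C != 0 :> R[i].
Proof.
rewrite -cnorm_eq0 cnorm_realp; have /andP[h _] := u_half i; last by lra.
by rewrite gt_eqF//; lra.
Qed.

Let cnorm_u i : cnorm (koerner_radius i)%:C = koerner_radius i.
Proof. by rewrite cnorm_realp//; have /andP[h _] := u_half i; lra. Qed.

(** Outside the discs, z over the pole radius keeps its distance from all N-th roots of unity, so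
    [unity_root_dist] applies. *)
Lemma factor_den_ge j z : outside_discs z ->
  e / (16 * (koerner_degree j)%:R ^+ 2) <= cnorm (1 - (z / (koerner_radius (2 * j).+1)%:C) ^+
    koerner_degree j).
Proof.
move=> hz; have /andP[e0 e1] := e01; have d1 : 1 <= (koerner_degree j)%:R :> R by rewrite ler1n.
have d2 : 1 <= (koerner_degree j)%:R ^+ 2 :> R by rewrite exprn_ege1.
have -> : e / (16 * (koerner_degree j)%:R ^+ 2) = e / (8 * (koerner_degree j)%:R ^+ 2) / 2.
  by field; rewrite pnatr_eq0 -lt0n.
rewrite -{2}(prednK (deg_gt0 j)); apply: unity_root_dist => [|i ij].
  apply/andP; split; first by rewrite divr_gt0 ?mulr_gt0 ?exprn_gt0 ?(lt_le_trans ltr01 d1).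
  by rewrite ler_pdivrMr ?mulr_gt0 ?exprn_gt0 ?(lt_le_trans ltr01 d1)//; lra.
rewrite prednK// in ij.
apply: (le_trans (disc_radius_ge ij)); apply: (le_trans (hz _)); rewrite (disc_centreE ij).
have /andP[h1 h2] := u_half (2 * j).+1.
rewrite (_ : z - _ = (koerner_radius (2 * j).+1)%:C * (z / (koerner_radius (2 * j).+1)%:C - omega
  (koerner_degree j).-1 ^+ i)).
  by rewrite cnormM cnorm_u ler_piMl ?cnorm_ge0.
by rewrite mulrBr mulrCA mulfV ?mulr1.
Qed.

Lemma factor_le j z : outside_discs z -> cnorm (koerner_factor j z) <= 16 * (koerner_degree j)%:R
  ^+ 2 / e.
Proof.
move=> /(factor_den_ge j) h; have /andP[e0 _] := e01.
have p0 : 0 < e / (16 * (koerner_degree j)%:R ^+ 2).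
  by rewrite divr_gt0// mulr_gt0// exprn_gt0// ltr0n.
rewrite /koerner_factor cnormV -[16 * _ / e]invf_div lef_pV2 ?posrE//.
exact: lt_le_trans h.
Qed.

Local Definition koerner_tail j : R := 2 / 2 ^+ koerner_level j.

Let pow_level j : 2 <= 2 ^+ koerner_level j :> R.
Proof.
rewrite -[X in X <= _]expr1; apply: ler_weXn2l; first by lra.
rewrite /koerner_level; lia.
Qed.

Lemma factor_out j z : koerner_radius (2 * j.+1) <= cnorm z -> cnorm (koerner_factor j z) <=
  koerner_tail j.
Proof.
move=> hz; rewrite (_ : 2 * j.+1 = (2 * j).+2)%N in hz; last by lia.
have /andP[h1 h2] := u_half (2 * j).+1.
have hw : 1 + 2^-1 ^+ (2 * j + 3) <= cnorm (z / (koerner_radius (2 * j).+1)%:C).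
  rewrite cnorm_div cnorm_u ler_pdivlMr; last by lra.
  rewrite mulrC (_ : 2 * j + 3 = (2 * j).+3)%N; last by lia.
  exact: le_trans (u_step _) hz.
have := two_pow_le (koerner_level j) hw; rewrite -cnormX -/(koerner_degree j).
rewrite /koerner_factor; move: (_ ^+ koerner_degree j) => W hW.
have hden : 2 ^+ koerner_level j / 2 <= cnorm (1 - W).
  have := cnorm_subl W 1; rewrite cnorm1 cnorm_dist; have := pow_level j; lra.
have p0 : 0 < 2 ^+ koerner_level j / 2 :> R by rewrite divr_gt0// exprn_gt0.
by rewrite /koerner_tail cnormV -[2 / _]invf_div lef_pV2 ?posrE// (lt_le_trans p0).
Qed.

Lemma factor_in j z : cnorm z <= koerner_radius (2 * j) -> cnorm (koerner_factor j z - 1) <=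
  koerner_tail j.
Proof.
move=> hz; have /andP[h1 h2] := u_half (2 * j).+1; have /andP[h3 h4] := u_half (2 * j).
have hx : 1 + 2^-1 ^+ (2 * j + 3) <= koerner_radius (2 * j).+1 / koerner_radius (2 * j).
  rewrite ler_pdivlMr; last by lra.
  rewrite mulrC; apply: le_trans (u_step _); rewrite ler_wpM2l//; first by lra.
  rewrite lerD2l (_ : 2 * j + 3 = (2 * j).+3)%N; last by lia.
  by rewrite exprS; have := half_ge0 (2 * j).+2; lra.
have := two_pow_le (koerner_level j) hx; rewrite -/(koerner_degree j) => hp.
have hW : cnorm ((z / (koerner_radius (2 * j).+1)%:C) ^+ koerner_degree j) <= (2 ^+ koerner_level
  j)^-1.
  rewrite cnormX cnorm_div cnorm_u (@le_trans _ _ ((koerner_radius (2 * j) / koerner_radius (2 *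
    j).+1) ^+ koerner_degree j))//.
    rewrite lerXn2r ?nnegrE ?divr_ge0 ?cnorm_ge0//; try lra.
    by rewrite ler_wpM2r// invr_ge0; lra.
  have p0 : 0 < 2 ^+ koerner_level j :> R by rewrite exprn_gt0.
  by rewrite -[koerner_radius _ / _]invf_div exprVn lef_pV2 ?posrE// (lt_le_trans p0).
rewrite /koerner_factor; move: ((_ / _) ^+ koerner_degree j) hW => W hW.
have hl : (2 ^+ koerner_level j)^-1 <= 2^-1 :> R by rewrite lef_pV2 ?posrE// exprn_gt0.
have hden : 2^-1 <= cnorm (1 - W) by have := cnorm_subl 1 W; rewrite cnorm1; lra.
have W1 : 1 - W != 0 by rewrite -cnorm_gt0; lra.
have -> : (1 - W)^-1 - 1 = W / (1 - W) by field.
rewrite cnorm_div /koerner_tail ler_pdivrMr; last by lra.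
apply: (le_trans hW); move: hl; set P := (2 ^+ _)^-1 => hl.
have P0 : 0 <= P by rewrite invr_ge0 exprn_ge0.
nra.
Qed.

Let two_pow_ge j : j.+1%:R <= 2 ^+ j :> R.
Proof. by rewrite -natrX ler_nat ltn_expl. Qed.

(** With X = 2^j the degree of stage j + 1 is at most 2^9 X^3 C, so 16 times its square is at most
    2^22 X^6 C^2. The constant 2^25 of [eC] leaves room for the division by 4 and the added 1. *)
Let deg_bound j : 16 * (koerner_degree j.+1)%:R ^+ 2 / e + 1 <= (2 ^+ j) ^+ 6 * 2 ^+ C / 4.
Proof.
have /andP[e0 e1] := e01.
have C1 : 1 <= C%:R :> R by rewrite ler1n.
have X1' : 1 <= 2 ^+ j :> R by apply: exprn_ege1; rewrite ler1n.
have X1 := two_pow_ge j; set X := 2 ^+ j in X1 X1' *.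
have j0 : 0 <= j%:R :> R by [].

have hN : (koerner_degree j.+1)%:R <= 512 * X ^+ 3 * C%:R.
  have -> : (koerner_degree j.+1)%:R = 32 * X ^+ 2 * (8 * j.+1%:R + C%:R).
    rewrite /koerner_degree natrM natrX (_ : 2 * j.+1 + 3 = j * 2 + 5)%N; last by lia.
    by rewrite exprD exprM /koerner_level natrD natrM -/X; congr (_ * _); ring.
  rewrite (_ : 512 * X ^+ 3 * C%:R = 32 * X ^+ 2 * (16 * X * C%:R)); last by ring.
  rewrite ler_wpM2l ?mulr_ge0 ?exprn_ge0//.
  have : X * 1 <= X * C%:R by rewrite ler_wpM2l//; lra.
  have : 1 * C%:R <= X * C%:R by rewrite ler_wpM2r//; lra.
  lra.
have hN2 : (koerner_degree j.+1)%:R ^+ 2 <= 2 ^+ 18 * X ^+ 6 * C%:R ^+ 2.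
  rewrite (_ : 2 ^+ 18 * X ^+ 6 * C%:R ^+ 2 = (512 * X ^+ 3 * C%:R) ^+ 2); last by ring.
  have b0 : 0 <= 512 * X ^+ 3 * C%:R by exact: le_trans hN.
  by apply: lerXn2r => //; rewrite nnegrE.
have X6 : 1 <= X ^+ 6 by rewrite exprn_ege1.
have C2 : 1 <= C%:R ^+ 2 :> R by rewrite exprn_ege1.
have XC : 1 <= X ^+ 6 * C%:R ^+ 2 by rewrite mulr_ege1.
have -> : 16 * (koerner_degree j.+1)%:R ^+ 2 / e + 1 = (16 * (koerner_degree j.+1)%:R ^+ 2 + e) / e.
  by field; rewrite gt_eqF.
rewrite ler_pdivrMr//.
have : X ^+ 6 * (2 ^+ 25 * C%:R ^+ 2) <= X ^+ 6 * (e * 2 ^+ C) by rewrite ler_wpM2l//; lra.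
have -> : X ^+ 6 * 2 ^+ C / 4 * e = X ^+ 6 * (e * 2 ^+ C) / 4 by field.
have -> : X ^+ 6 * (2 ^+ 25 * C%:R ^+ 2) = 2 ^+ 25 * (X ^+ 6 * C%:R ^+ 2) by ring.
move: hN2; rewrite -[_ * X ^+ 6 * _]mulrA; move: (X ^+ 6 * C%:R ^+ 2) XC => T T1.
move: (X ^+ 6 * (e * 2 ^+ C)) ((koerner_degree j.+1)%:R ^+ 2) => V D hD hV.
rewrite (_ : 2 ^+ 25 = 128 * 2 ^+ 18) in hV; last by ring.
have p18 : 1 <= 2 ^+ 18 :> R by apply: exprn_ege1; rewrite ler1n.
have : T <= 2 ^+ 18 * T by rewrite ler_peMl//; lra.
lra.
Qed.

Let tailE j : koerner_tail j = 2 / ((2 ^+ j) ^+ 8 * 2 ^+ C).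
Proof. by rewrite /koerner_tail /koerner_level exprD mulnC exprM. Qed.

Lemma tail_bound j : koerner_tail j * (16 * (koerner_degree j.+1)%:R ^+ 2 / e + 1) <= 2^-1 ^+ j.+1.
Proof.
have X1 : 1 <= 2 ^+ j :> R by apply: exprn_ege1; rewrite ler1n.
have E0 : 0 < 2 ^+ C :> R by rewrite exprn_gt0.
have X0 : 0 < 2 ^+ j :> R by rewrite exprn_gt0.
have t0 : 0 <= koerner_tail j by rewrite divr_ge0 ?exprn_ge0.
apply: le_trans (ler_wpM2l t0 (deg_bound j)) _; rewrite tailE exprVn (exprS _ j).
move: (2 ^+ j) (2 ^+ C) X1 E0 X0 => X E X1 E0 X0.
have -> : 2 / (X ^+ 8 * E) * (X ^+ 6 * E / 4) = (2 * X ^+ 2)^-1.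
  by field; rewrite !gt_eqF.
have X2 : X <= X ^+ 2 by rewrite expr2 ler_peMl// ltW.
have p1 : 0 < 2 * X by rewrite mulr_gt0.
by rewrite lef_pV2 ?posrE//; lra.
Qed.

Lemma tail_bound0 j : (16 * (koerner_degree 0)%:R ^+ 2 / e + 1) * koerner_tail j <= 2^-1 ^+ j.+3.
Proof.
have /andP[e0 e1] := e01.
have X1 : 1 <= 2 ^+ j :> R by apply: exprn_ege1; rewrite ler1n.
have E0 : 0 < 2 ^+ C :> R by rewrite exprn_gt0.
have X0 : 0 < 2 ^+ j :> R by rewrite exprn_gt0.
have t0 : 0 <= koerner_tail j by rewrite divr_ge0 ?exprn_ge0.
have C2 : 1 <= C%:R ^+ 2 :> R by apply: exprn_ege1; rewrite ler1n.
have hK : 16 * (koerner_degree 0)%:R ^+ 2 / e + 1 <= 2 ^+ C / 16.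
  have -> : (koerner_degree 0)%:R = 8 * C%:R :> R by rewrite /koerner_degree /koerner_level muln0
    add0n natrM.
  have -> : 16 * (8 * C%:R) ^+ 2 / e + 1 = (2 ^+ 10 * C%:R ^+ 2 + e) / e.
    by field; rewrite gt_eqF.
  rewrite ler_pdivrMr//.
  have T1 : 1 <= 2 ^+ 10 * C%:R ^+ 2 :> R.
    by rewrite mulr_ege1//; apply: exprn_ege1; rewrite ler1n.
  have := eC; rewrite (_ : 2 ^+ 25 * _ = 2 ^+ 15 * (2 ^+ 10 * C%:R ^+ 2)); last first.
    by rewrite mulrA -exprD.
  move: (2 ^+ 10 * _) T1 => T T1 hT.
  have : 2 ^+ 5 * T <= 2 ^+ 15 * T.
    by rewrite ler_wpM2r//; [lra|apply: ler_weXn2l; rewrite ?ler1n].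
  rewrite (_ : 2 ^+ 5 = 32); last by ring.
  lra.
apply: le_trans (ler_wpM2r t0 hK) _; rewrite tailE exprVn (exprS _ j.+2) (exprS _ j.+1) (exprS _ j).
move: (2 ^+ j) (2 ^+ C) X1 E0 X0 => X E X1 E0 X0.
have -> : E / 16 * (2 / (X ^+ 8 * E)) = (8 * X ^+ 8)^-1.
  by field; rewrite !gt_eqF.
have X8 : X <= X ^+ 8.
  by rewrite exprS ler_peMr ?(ltW X0)//; apply: exprn_ege1.
by rewrite lef_pV2 ?posrE//; lra.
Qed.

Lemma koerner_limit : exists G : R[i] -> R[i],
  [/\ forall z, outside_discs z -> 1 <= cnorm z -> G z = 0,
      forall z, outside_discs z -> cnorm z <= 2^-1 -> G z != 0 &
      forall d : R, 0 < d -> exists n, forall z, outside_discs z ->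
        cnorm (G z - \prod_(j < n) koerner_factor j z) < d].
Proof.
have /andP[e0 e1] := e01.
apply: (@product_limit _ outside_discs koerner_factor (fun j => koerner_radius (2 * j)) koerner_tail
  (fun j => 16 * (koerner_degree j)%:R ^+ 2 / e)).
- by rewrite /koerner_radius muln0 expr1; lra.
- move=> i j ij; rewrite /koerner_radius lerD2l lerN2; apply: ler_wiXn2l; try lra.
  by rewrite ltnS leq_mul2l.
- by move=> j; have /andP[] := u_half (2 * j).
- by move=> j; rewrite divr_ge0// exprn_ge0.
- by move=> j; rewrite divr_ge0 ?mulr_ge0 ?exprn_ge0// ltW.
- by move=> j z; apply: factor_le.
- by move=> j z _; apply: factor_out.
- by move=> j z _; apply: factor_in.
- exact: tail_bound.
- exact: tail_bound0.
Qed.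

Lemma factor_den_neq0 j z : outside_discs z ->
  1 - (z / (koerner_radius (2 * j).+1)%:C) ^+ koerner_degree j != 0.
Proof.
move=> /(factor_den_ge j); have /andP[e0 _] := e01; rewrite -cnorm_gt0; apply: lt_le_trans.
by rewrite divr_gt0// mulr_gt0// exprn_gt0// ltr0n.
Qed.

Lemma koerner_function (a : R[i]) (s : R) : 0 < s ->
  exists (c : nat -> R[i]) (r : nat -> R) (G : R[i] -> R[i]),
  [/\ forall l, r l = s * e / (l.+1%:R * l.+2%:R),
      forall l, cnorm (c l - a) <= s &
      let Z := [set z | forall l, r l <= cnorm (z - c l)] in
      [/\ forall z, Z z -> s <= cnorm (z - a) -> G z = 0,
          forall z, Z z -> cnorm (z - a) <= s / 2 -> G z != 0 &
          forall d : R, 0 < d -> exists p q, forall z, Z z ->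
            q.[z] != 0 /\ cnorm (G z - p.[z] / q.[z]) < d]].
Proof.
move=> s0; have sC0 : s%:C != 0 :> R[i] by rewrite -cnorm_eq0 cnorm_realp ?gt_eqF// ltW.
have cs : cnorm s%:C = s by rewrite cnorm_realp// ltW.
have [G [G0 G1 GA]] := koerner_limit.
exists (fun l => a + s%:C * disc_centre l), (fun l => s * disc_radius l),
  (fun z => G ((z - a) / s%:C)).
have ZE z : (forall l, s * disc_radius l <= cnorm (z - (a + s%:C * disc_centre l))) ->
    outside_discs ((z - a) / s%:C).
  move=> h l; have := h l.
  have -> : z - (a + s%:C * disc_centre l) = s%:C * ((z - a) / s%:C - disc_centre l).
    by rewrite mulrBr mulrCA mulfV// mulr1 opprD addrA.
  by rewrite cnormM cs ler_pM2l.
have nE z : cnorm ((z - a) / s%:C) = cnorm (z - a) / s by rewrite cnorm_div cs.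
split.
- by move=> l; rewrite /disc_radius mulrA.
- move=> l; rewrite addrC addKr cnormM cs ler_piMr ?(ltW s0)//.
  exact: disc_centre_le.
split.
- by move=> z /ZE hz sz; apply: G0 => //; rewrite nE ler_pdivlMr// mul1r.
- by move=> z /ZE hz sz; apply: G1 => //; rewrite nE ler_pdivrMr// mulrC.
move=> d /GA[n hn].
exists 1, (\prod_(j < n) (1 - ((s * koerner_radius (2 * j).+1)%:C^-1 *: ('X - a%:P)) ^+
  koerner_degree j)).
move=> z /ZE hz; rewrite horner_prod.
have E j : (1 - ((s * koerner_radius (2 * j).+1)%:C^-1 *: ('X - a%:P)) ^+ koerner_degree j).[z] =
    1 - ((z - a) / s%:C / (koerner_radius (2 * j).+1)%:C) ^+ koerner_degree j.
  rewrite hornerD hornerN horner_exp hornerC hornerZ hornerXsubC.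
  by rewrite rmorphM invfM mulrC mulrA.
under eq_bigr do rewrite E.
split; first by apply/prodf_neq0 => j _; apply: factor_den_neq0.
by have := hn _ hz; rewrite /koerner_factor prodfV hornerC mul1r.
Qed.

End KoernerFactors.

Section McKissick.
Context {R : realType}.

(** Take C = 3c with c >= 9 |B|: then B C^2 <= c^3 <= (2^c)^3. *)
Lemma two_pow_dominates (B : R) : exists2 C, (0 < C)%N & B * C%:R ^+ 2 <= 2 ^+ C.
Proof.
pose c := (Num.bound (9 * `|B|)).+1; exists (c + c + c)%N; first by rewrite /c.
have X1 : c%:R <= 2 ^+ c :> R by rewrite -natrX ler_nat ltnW// ltn_expl.
have hB : 9 * `|B| <= c%:R.
  have /archi_boundP/ltW h : 0 <= 9 * `|B| by rewrite mulr_ge0.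
  by apply: le_trans h _; rewrite ler_nat leqnSn.
have c0 : 0 <= c%:R :> R by [].
rewrite !natrD !exprD; move: (c%:R : R) (2 ^+ c) X1 hB c0 => x X X1 hB c0.
have h1 : B * (x + x + x) ^+ 2 <= (9 * `|B|) * x ^+ 2.
  rewrite (_ : B * _ = 9 * B * x ^+ 2); last by ring.
  by rewrite ler_wpM2r ?exprn_ge0// ler_wpM2l// ler_norm.
apply: (le_trans h1); rewrite -[X in _ <= X]mulrA mulrC expr2 mulrC.
by rewrite ler_pM ?mulr_ge0 ?ler_pM//; apply: le_trans X1.
Qed.

(* Koerner's form of McKissick's lemma. *)
Lemma mckissick (a : R[i]) (s e : R) : 0 < s -> 0 < e ->
  exists (c : nat -> R[i]) (r : nat -> R) (G : R[i] -> R[i]),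
  [/\ forall l, 0 < r l <= e / (l.+1%:R * l.+2%:R),
      forall l, cnorm (c l - a) <= s &
      let Z := [set z | forall l, r l <= cnorm (z - c l)] in
      [/\ forall z, Z z -> s <= cnorm (z - a) -> G z = 0,
          forall z, Z z -> cnorm (z - a) <= s / 2 -> G z != 0 &
          forall d : R, 0 < d -> exists p q, forall z, Z z ->
            q.[z] != 0 /\ cnorm (G z - p.[z] / q.[z]) < d]].
Proof.
(* [koerner_function] wants a parameter at most 1 and multiplies the radii by [s], so s e' must not
   exceed e. *)
move=> s0 e0; pose e' := Num.min 1 (e / s).
have e'0 : 0 < e' by rewrite lt_min ltr01 divr_gt0.
have e'01 : 0 < e' <= 1 by rewrite e'0 ge_min lexx.
have [C C0 hC] := two_pow_dominates (2 ^+ 25 / e').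
have [|c [r [G [rE cs hG]]]] := koerner_function e'01 C0 _ a s0.
  by move: hC; rewrite mulrAC ler_pdivrMr// [2 ^+ C * _]mulrC.
exists c, r, G; split=> // l; rewrite rE.
have h : 0 < (l.+1%:R * l.+2%:R)^-1 :> R by rewrite invr_gt0 mulr_gt0// ltr0n.
rewrite !mulr_gt0//= ler_pM2r// mulrC -ler_pdivlMr//.
by rewrite ge_min lexx orbT.
Qed.

End McKissick.

(** * Construction of the Swiss cheese *)

Section RationalClosure.
Context {R : realType}.
Implicit Types (X : set R[i]) (f : R[i] -> R[i]) (p q : {poly R[i]}).

Lemma ratio_continuous p q x (e : R) : q.[x] != 0 -> 0 < e ->
  exists2 d : R, 0 < d & forall w, cnorm (x - w) < d -> q.[w] != 0 ->
    cnorm (p.[w] / q.[w] - p.[x] / q.[x]) < e.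
Proof.
move=> qx e0; have cqx : 0 < cnorm q.[x] by rewrite cnorm_gt0.
(* [N] vanishes at [x], and the difference of the two quotients is N(w) / (q(w) q(x)). *)
pose N := q.[x] *: p - p.[x] *: q.
have Nx : N.[x] = 0 by rewrite /N !hornerE mulrC subrr.
have [|d1 d10 h1] := @poly_continuous _ N x (e * (cnorm q.[x] / 2 * cnorm q.[x])).
  by rewrite !mulr_gt0.
have [|d2 d20 h2] := @poly_continuous _ q x (cnorm q.[x] / 2).
  by rewrite divr_gt0.
exists (Num.min d1 d2); first by rewrite lt_min d10.
move=> w; rewrite lt_min => /andP[/h1 k1 /h2 k2] qw.
have -> : p.[w] / q.[w] - p.[x] / q.[x] = N.[w] / (q.[w] * q.[x]).
  by rewrite /N !hornerE; field; rewrite qw qx.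
rewrite Nx subr0 in k1.
rewrite cnorm_div cnormM ltr_pdivrMr ?mulr_gt0 ?cnorm_gt0//.
apply: (lt_le_trans k1); rewrite ler_pM2l// ler_pM2r//.
by have := cnorm_subl q.[x] q.[w]; rewrite cnorm_dist; lra.
Qed.

Lemma closure_rational_continuous X f :
  (forall e : R, 0 < e -> exists p q, forall z, X z ->
    q.[z] != 0 /\ cnorm (f z - p.[z] / q.[z]) < e) -> {within X, continuous f}.
Proof.
move=> h; apply/subspace_continuousP => x Xx.
apply/cvg_cnormP => e e0; have e30 : 0 < e / 3 by rewrite divr_gt0.
have [p [q pq]] := h _ e30; have [qx fx] := pq x Xx.
have [d d0 hd] := ratio_continuous p qx e30.
apply/nbhs_cnormP; exists d => // w xw Xw; have [qw fw] := pq w Xw.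
change (cnorm (f x - f w) < e).
have := hd w xw qw; rewrite (cnorm_dist (p.[w] / _)).
have := cnorm_tri (f x) (f w) (p.[x] / q.[x]).
have := cnorm_tri (p.[x] / q.[x]) (f w) (p.[w] / q.[w]).
by rewrite (cnorm_dist (p.[w] / q.[w]) (f w)); lra.
Qed.

Lemma compact_nonvanishing_bound X q : compact X -> (forall z, X z -> q.[z] != 0) ->
  exists2 B : R, 0 < B & forall z, X z -> 1 < B * cnorm q.[z].
Proof.
rewrite compact_cover => cX qX.
have [||D _ DX] := cX nat setT (fun n => [set z | cnorm (1 : {poly R[i]}).[z] < n.+1%:R * cnorm
  q.[z]]).
- by move=> n _; apply: open_poly_lt; rewrite ltr0n.
- move=> z /qX qz; have cq : 0 < cnorm q.[z] by rewrite cnorm_gt0.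
  exists (Num.bound (cnorm q.[z])^-1) => //=; rewrite hornerC cnorm1.
  rewrite -ltr_pdivrMr// div1r.
  have /archi_boundP h : 0 <= (cnorm q.[z])^-1 by rewrite invr_ge0 ltW.
  by apply: lt_le_trans h _; rewrite ler_nat leqnSn.
exists (\sum_(n <- finmap.enum_fset D) n.+1%:R + 1).
  by rewrite ltr_wpDl// sumr_ge0.
move=> z /DX[n /= nD]; rewrite hornerC cnorm1 => h; apply: (lt_le_trans h).
rewrite ler_wpM2r ?cnorm_ge0//; have nD' : n \in finmap.enum_fset D by [].
rewrite (perm_big _ (perm_to_rem nD')) big_cons -addrA lerDl addr_ge0// sumr_ge0//.
Qed.

Lemma closure_rational_bounded X f : compact X -> (forall z, X z -> cnorm z <= 1) ->
  (forall e : R, 0 < e -> exists p q, forall z, X z ->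
    q.[z] != 0 /\ cnorm (f z - p.[z] / q.[z]) < e) ->
  exists2 B : R, 0 < B & forall z, X z -> cnorm (f z) < B.
Proof.
move=> cX X1 h; have [p [q pq]] := h 1 ltr01.
have [|B1 B10 hB1] := @compact_nonvanishing_bound X q cX.
  by move=> z /pq[].
have [B2 B20 hB2] := poly_bounded p 1.
exists (B2 * B1 + 1); first by rewrite addr_gt0 ?mulr_gt0.
move=> z Xz; have [qz fz] := pq z Xz.
have h1 : cnorm (p.[z] / q.[z]) <= B2 * B1.
  rewrite cnorm_div; apply: ler_pM; rewrite ?invr_ge0 ?cnorm_ge0 ?hB2 ?X1//.
  rewrite -[_^-1]mul1r ler_pdivrMr ?cnorm_gt0//; exact/ltW/hB1.
have := cnormD (f z - p.[z] / q.[z]) (p.[z] / q.[z]); rewrite subrK; lra.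
Qed.

End RationalClosure.

Section HalfSegment.
Context {R : realType}.
Local Notation I := (@half_segment R).

Lemma half_segmentP z : I z <-> complex.Im z = 0 /\ `|complex.Re z| <= 2^-1.
Proof.
split=> [[x /= xI <-]|[z0 zh]].
  by split=> //=; rewrite ler_norml; move: xI; rewrite in_itv.
exists (complex.Re z); first by rewrite /= in_itv /= -ler_norml.
by case: z z0 {zh} => a b /= ->.
Qed.

Lemma half_segment0 : I 0.
Proof. by apply/half_segmentP; rewrite /= normr0; split=> //; lra. Qed.

Lemma half_segment_le z : I z -> cnorm z <= 2^-1.
Proof.
move=> /half_segmentP[z0 zh]; apply: (le_trans (cnorm_le_ReIm z)).
by rewrite z0 normr0 addr0.
Qed.

Lemma half_segment_perfect x (d : R) : I x -> 0 < d ->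
  exists w, [/\ I w, w != x & cnorm (x - w) < d].
Proof.
move=> /half_segmentP[x0 xh] d0.
have [y [yh yx yd]] : exists y, [/\ `|y| <= 2^-1, y != complex.Re x & `|complex.Re x - y| < d].
  move: xh; rewrite ler_norml => /andP[h1 h2].
  have m0 : 0 < Num.min (d / 2) (2^-1) by rewrite lt_min divr_gt0//; lra.
  have m1 : Num.min (d / 2) (2^-1) <= d / 2 by rewrite ge_min lexx.
  have m2 : Num.min (d / 2) (2^-1) <= 2^-1 :> R by rewrite ge_min lexx orbT.
  move: (Num.min _ _) m0 m1 m2 => m m0 m1 m2.
  have [x00|x00] := leP (complex.Re x) 0.
    exists (complex.Re x + m); split.
    - by rewrite ler_norml; lra.
    - by rewrite gt_eqF//; lra.
    - by rewrite opprD addNKr normrN gtr0_norm//; lra.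
  exists (complex.Re x - m); split.
  - by rewrite ler_norml; lra.
  - by rewrite lt_eqF//; lra.
  - by rewrite opprB addrC subrK gtr0_norm//; lra.
exists y%:C; split; first by apply/half_segmentP.
  by apply: contraNneq yx => <-.
apply: (le_lt_trans (cnorm_le_ReIm _)); move: x0 yd; case: (x) => a b /= -> yd.
by rewrite subrr normr0 addr0.
Qed.

Lemma half_segment_far x : ~ I x ->
  exists2 d : R, 0 < d & forall z, I z -> d <= cnorm (x - z).
Proof.
move=> xI; have [x0|x0] := eqVneq (complex.Im x) 0; last first.
  exists `|complex.Im x|; first by rewrite normr_gt0.
  move=> z /half_segmentP[z0 _]; have := cnorm_Im (x - z).
  by rewrite raddfB /= z0 subr0.
have xh : 2^-1 < `|complex.Re x|.
  by rewrite ltNge; apply/negP => h; apply: xI; apply/half_segmentP.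
exists (`|complex.Re x| - 2^-1); first by rewrite subr_gt0.
move=> z /half_segmentP[_ zh]; have := cnorm_Re (x - z); rewrite raddfB /=.
by have := lerB_dist (complex.Re x) (complex.Re z); lra.
Qed.

Let grid_centre (t : int * int * nat) : R[i] :=
  (t.1.1%:~R / 2 ^+ t.2) +i* (t.1.2%:~R / 2 ^+ t.2).
Let grid_radius (t : int * int * nat) : R := 4 / 2 ^+ t.2.

Lemma floor_approx (x : R) p : exists k : int, `|x - k%:~R / 2 ^+ p| <= (2 ^+ p)^-1.
Proof.
have X0 : 0 < 2 ^+ p :> R by rewrite exprn_gt0.
exists (Num.floor (x * 2 ^+ p)); have h1 := floor_le (x * 2 ^+ p).
have h2 := floorD1_gt (x * 2 ^+ p).
have -> : x - (Num.floor (x * 2 ^+ p))%:~R / 2 ^+ p =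
    (x * 2 ^+ p - (Num.floor (x * 2 ^+ p))%:~R) / 2 ^+ p by field; rewrite gt_eqF.
rewrite normrM [`|_^-1|]ger0_norm ?invr_ge0 ?(ltW X0)//.
rewrite -[X in _ <= X]mul1r ler_wpM2r ?invr_ge0 ?(ltW X0)//.
rewrite ger0_norm ?subr_ge0// lerBlDr addrC ltW//.
by rewrite intrD in h2.
Qed.

(** Dyadic grid points of mesh 2^-p carry discs of radius 4 / 2^p, so every x is within half the
    radius of some centre; discs too close to I are discarded. *)
Lemma grid_discs : exists (a : nat -> R[i]) (s : nat -> R),
  [/\ forall m, 0 < s m, forall m z, I z -> 2 * s m <= cnorm (z - a m) &
    forall x (d : R), ~ I x -> 0 < d -> exists m, cnorm (x - a m) <= s m / 2 /\ s m < d].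
Proof.
pose valid t := `[< forall z, I z -> 2 * grid_radius t <= cnorm (z - grid_centre t) >].
(* Filler for discarded codes: centre 16 / 2^3 = 2 and radius 1/2, the centre being at distance at
   least 3/2 from I. *)
pose t0 : int * int * nat := (16%:Z, 0, 3%N).
have v0 : valid t0.
  apply/asboolP => z /half_segment_le zh; rewrite /grid_radius /grid_centre /=.
  have -> : (16%:Z%:~R / 2 ^+ 3) +i* (0%:~R / 2 ^+ 3) = 2%:C :> R[i].
    by congr (_ +i* _); [field|rewrite mul0r].
  have := cnorm_subl 2%:C z; rewrite cnorm_dist cnorm_realp//.
  rewrite (_ : 2 * (4 / 2 ^+ 3) = 1); [lra|by field].
pose code m := if unpickle m is Some t then (if valid t then t else t0) else t0.
have codeV m : valid (code m) by rewrite /code; case: unpickle => // t; case: ifP.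
exists (fun m => grid_centre (code m)), (fun m => grid_radius (code m)); split.
- by move=> m; rewrite divr_gt0// exprn_gt0.
- by move=> m; have /asboolP := codeV m.
move=> x d xI d0; have [e e0 he] := half_segment_far xI.
(* If x is at distance at least e from I and the radius s is below e / 3, the centre is at distance
   at least e - s / 2 >= 2 s. *)
have [p hp] : exists p : nat, 4 / 2 ^+ p < Num.min d (e / 3).
  have m0 : 0 < Num.min d (e / 3) by rewrite lt_min d0 divr_gt0.
  exists (Num.bound (4 / Num.min d (e / 3))).
  rewrite ltr_pdivrMr ?exprn_gt0// mulrC -ltr_pdivrMr//.
  have /archi_boundP h : 0 <= 4 / Num.min d (e / 3) by rewrite divr_ge0// ltW.
  by apply: lt_trans h _; rewrite -natrX ltr_nat ltn_expl.
have [k hk] := floor_approx (complex.Re x) p.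
have [l hl] := floor_approx (complex.Im x) p.
have xa : cnorm (x - grid_centre (k, l, p)) <= grid_radius (k, l, p) / 2.
  apply: (le_trans (cnorm_le_ReIm _)); rewrite !raddfB /grid_radius /grid_centre /=; lra.
move: hp; rewrite lt_min -/(grid_radius (k, l, p)) => /andP[h1 h2].
have vt : valid (k, l, p).
  apply/asboolP => z Iz; have := he z Iz; have := cnorm_tri x z (grid_centre (k, l, p)).
  rewrite (cnorm_dist (grid_centre _) z); lra.
by exists (pickle (k, l, p)); rewrite /code pickleK vt.
Qed.

End HalfSegment.

Section PairSums.
Context {R : realType}.

Lemma sum_inv_prod n : \sum_(l < n) (l.+1%:R * l.+2%:R)^-1 = 1 - n.+1%:R^-1 :> R.
Proof.
elim: n => [|n IH]; first by rewrite big_ord0 invr1 subrr.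
rewrite big_ord_recr /= IH -(natr1 n.+1) -!natr1.
have h : 0 <= n%:R :> R by [].
by field; apply/andP; split; rewrite gt_eqF//; lra.
Qed.

Lemma sum_half_pow n : \sum_(m < n) 2^-1 ^+ m.+1 = 1 - 2^-1 ^+ n :> R.
Proof.
elim: n => [|n IH]; first by rewrite big_ord0 expr0 subrr.
by rewrite big_ord_recr /= IH exprS; field.
Qed.

(** A finite set of pairs is enlarged to a square grid, where the sum factors into partial sums of
    two series of sum 1. *)
Lemma pair_sum_le (ps : seq (nat * nat)) (w : nat * nat -> R) (D : R) : 0 <= D ->
  uniq ps ->
  (forall x, x \in ps -> w x <= D * 2^-1 ^+ x.1.+1 * (x.2.+1%:R * x.2.+2%:R)^-1) ->
  \sum_(x <- ps) w x <= D.
Proof.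
move=> D0 ups hw; pose F x := D * 2^-1 ^+ x.1.+1 * (x.2.+1%:R * x.2.+2%:R)^-1 : R.
have F0 x : 0 <= F x.
  by rewrite /F mulr_ge0 ?invr_ge0 ?mulr_ge0 ?exprn_ge0.
apply: (@le_trans _ _ (\sum_(x <- ps) F x)).
  by rewrite big_seq [X in _ <= X]big_seq; apply: ler_sum.
have [N hN] : exists N, forall x, x \in ps -> (x.1 < N)%N && (x.2 < N)%N.
  elim: (ps) => [|x t [N hN]]; first by exists 0%N.
  exists (maxn N (maxn x.1 x.2).+1) => y; rewrite inE.
  move=> /orP[/eqP->|/hN/andP[h1 h2]]; first by rewrite !leq_max !ltnS leq_maxl leq_maxr !orbT.
  by rewrite !leq_max h1 h2.
pose grid := [seq (i, j) | i <- iota 0 N, j <- iota 0 N].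
have ugrid : uniq grid.
  by apply: allpairs_uniq; rewrite ?iota_uniq// => -[? ?] [? ?] _ _ /= [-> ->].
have pg : perm_eq ps [seq x <- grid | x \in ps].
  apply: uniq_perm => //; first exact: filter_uniq.
  move=> x; rewrite mem_filter; have [xps|//] := boolP (x \in ps).
  have /andP[iN jN] := hN _ xps; apply/esym/allpairsP; exists x.
  by rewrite !mem_iota !add0n iN jN; case: (x).
rewrite (perm_big _ pg) big_filter /=.
apply: (@le_trans _ _ (\sum_(x <- grid) F x)).
  by rewrite big_mkcond /=; apply: ler_sum => x _; case: ifP.
rewrite big_allpairs /=.
have -> : \sum_(i <- iota 0 N) \sum_(j <- iota 0 N) F (i, j) =
    D * (\sum_(i < N) 2^-1 ^+ i.+1) * (\sum_(j < N) (j.+1%:R * j.+2%:R)^-1).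
  rewrite -(big_mkord xpredT (fun i => 2^-1 ^+ i.+1)).
  rewrite -(big_mkord xpredT (fun j => (j.+1%:R * j.+2%:R)^-1)) /index_iota subn0.
  by rewrite [D * _]mulr_sumr mulr_suml; apply: eq_bigr => i _; rewrite mulr_sumr.
rewrite sum_half_pow sum_inv_prod -mulrA ler_piMr// mulr_ile1 ?gerBl ?exprn_ge0//.
- by rewrite subr_ge0 exprn_ile1//; lra.
- by rewrite subr_ge0 invf_le1// ler1n.
Qed.

End PairSums.

(** * Logarithmic weights *)

Section LogarithmicWeights.
Context {R : realType}.

Definition log_weight k : nat := (trunc_log 2 k).+1.

(** The weight exceeds A for all large k; the remaining k are finitely many, and e pays for them. *)
Lemma log_weight_absorbs (A : R) : 1 <= A ->
  exists2 e : R, 0 < e & forall k, e * A ^+ k.+1 <= (log_weight k)%:R ^+ k.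
Proof.
move=> A1; pose K := (2 ^ Num.bound A)%N.
have A0 : 0 < A by lra.
have L1 k : 1 <= (log_weight k)%:R :> R by rewrite ler1n.
exists (A ^+ K.+1)^-1; first by rewrite invr_gt0 exprn_gt0.
move=> k; rewrite mulrC ler_pdivrMr ?exprn_gt0//.
have [kK|Kk] := ltnP k K.
  apply: (@le_trans _ _ (A ^+ K.+1)); first by apply: ler_weXn2l => //; lia.
  by rewrite ler_peMl ?exprn_ge0 ?(ltW A0)//; apply: exprn_ege1.
have AL : A <= (log_weight k)%:R.
  have /archi_boundP/ltW h : 0 <= A by lra.
  apply: (le_trans h); rewrite ler_nat /log_weight.
  apply: (@leq_trans (trunc_log 2 K)); first by rewrite /K trunc_expnK.
  exact: leqW (leq_trunc_log 2 Kk).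
rewrite [A ^+ k.+1]exprS mulrC; apply: ler_pM; rewrite ?exprn_ge0 ?(ltW A0)//.
  by apply: lerXn2r => //; rewrite nnegrE ltW.
by rewrite -[X in X <= _]expr1; apply: ler_weXn2l.
Qed.

(** Cauchy condensation: the weight is J + 1 for k from 2^J up to 2^(J+1) - 1, and this block
    contributes at least 1 / (2 (J + 1)). *)
Lemma log_weight_dvg (A : R) : exists n,
  A <= \sum_(1 <= k < n) (k%:R * (log_weight k)%:R)^-1.
Proof.
have block J : \sum_(j < J) (2 * j.+1%:R)^-1 <=
    \sum_(1 <= k < 2 ^ J) (k%:R * (log_weight k)%:R)^-1 :> R.
  elim: J => [|J IH]; first by rewrite big_ord0 big_geq.
  rewrite big_ord_recr /= (big_cat_nat (n := (2 ^ J)%N)) //=; last 2 first.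
  - by rewrite expn_gt0.
  - by rewrite leq_exp2l.
  apply: lerD => //.
  apply: (@le_trans _ _ (\sum_(2 ^ J <= k < 2 ^ J.+1) ((2 ^ J.+1)%:R * J.+1%:R)^-1)).
    rewrite sumr_const_nat expnS mul2n -addnn addnK addnn -mul2n natrM.
    have h : (2 ^ J)%:R != 0 :> R by rewrite pnatr_eq0 -lt0n expn_gt0.
    rewrite -mulr_natl le_eqVlt; apply/orP; left; apply/eqP; field.
    by rewrite h addrC natr1 pnatr_eq0.
  apply: ler_sum_nat => k /andP[k1 k2].
  have k0 : (0 < k)%N by apply: leq_trans k1; rewrite expn_gt0.
  rewrite lef_pV2 ?posrE ?mulr_gt0 ?ltr0n ?expn_gt0//.
  have -> : log_weight k = J.+1.
    rewrite /log_weight; congr _.+1; apply: trunc_log_eq => //.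
    by rewrite k1 k2.
  by rewrite ler_wpM2r// ler_nat ltnW.
have hd : nondecreasing_seq (series (@harmonic R)).
  apply: nondecreasing_series => n *; exact: (harmonic_ge0 n).
have /cvgryPge/(_ (2 * A))[J _ hJ] := nondecreasing_dvgn_lt hd (@dvg_harmonic R).
exists (2 ^ J)%N; apply: le_trans (block J).
have := hJ J (leqnn J); rewrite /series /= big_mkord /harmonic => h.
have -> : \sum_(j < J) (2 * j.+1%:R)^-1 = 2^-1 * \sum_(j < J) j.+1%:R^-1 :> R.
  by rewrite mulr_sumr; apply: eq_bigr => j _; rewrite invfM.
lra.
Qed.

End LogarithmicWeights.

(** * The family of deleted discs *)

Section DiscFamily.
Context {R : realType}.
Lemma nat_pair_bijection : exists f : nat -> nat * nat,
  injective f /\ forall x, exists n, f n = x.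
Proof.
have /card_esym/pcard_eqP/bijPex[f [_ fi fs]] := card_nat2.
exists f; split=> [m n|x]; first by apply: fi; rewrite inE.
by have [n _ <-] := fs x I; exists n.
Qed.

Local Notation I := (@half_segment R).

Lemma disc_family : exists (c : nat -> R[i]) (r : nat -> R) (lev : nat -> nat) (d : nat -> R),
 [/\ forall n, 0 < r n, forall m, 0 < d m, d 0%N <= 2^-1,
     forall m n, (m <= n)%N -> d n <= d m &
  [/\ forall n z, I z -> d (lev n) + r n <= cnorm (z - c n),
      forall s m, uniq s -> (forall n, n \in s -> (m <= lev n)%N) ->
        \sum_(n <- s) r n <= d m / 8,
      forall s k, uniq s ->
        \sum_(n <- s) r n * (2 / d (lev n)) ^+ k.+1 <= (log_weight k)%:R ^+ k &
      forall x y, ~ I x -> y != x -> exists (G : R[i] -> R[i]) (a : R[i]) (s : R),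
        let Z := [set z | forall n, r n <= cnorm (z - c n)] in
        [/\ cnorm (x - a) <= s / 2, s < cnorm (y - a),
            forall z, Z z -> s <= cnorm (z - a) -> G z = 0,
            forall z, Z z -> cnorm (z - a) <= s / 2 -> G z != 0 &
            forall e : R, 0 < e -> exists p q, forall z, Z z ->
              q.[z] != 0 /\ cnorm (G z - p.[z] / q.[z]) < e]]].
Proof.
have [a [s [s0 aI agrid]]] := @grid_discs R.
pose mn m := Num.min 1 (s m).
have mn0 m : 0 < mn m by rewrite lt_min ltr01 s0.
have mn1 m : mn m <= 1 by rewrite ge_min lexx.
(* Decreasing and at most s_m / 2. The deleted centres of level m are within s_m of a_m, hence at
   distance at least s_m >= 2 d_m from I, which leaves d_m for the radius. *)
pose d m := 2^-1 * \prod_(i < m.+1) mn i.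
have d0 m : 0 < d m by rewrite mulr_gt0// prodr_gt0.
have dS m : d m.+1 <= d m.
  by rewrite /d big_ord_recr /= mulrA ler_piMr ?mn1// (ltW (d0 m)).
have d_decr m n : (m <= n)%N -> d n <= d m.
  by move=> /subnKC <-; elim: (n - m)%N => [|k IH]; rewrite ?addn0// addnS (le_trans (dS _)).
have d00 : d 0%N <= 2^-1 by rewrite /d big_ord1 ler_piMr.
have dh m : d m <= 2^-1 by apply: le_trans d00; apply: d_decr.
have ds m : d m <= s m / 2.
  rewrite /d mulrC ler_wpM2r// big_ord_recr /=.
  apply: (@le_trans _ _ (mn m)); last by rewrite ge_min lexx orbT.
  rewrite ler_piMl ?(ltW (mn0 m))//.
  by apply: (prod_le1 (a := mn)) => i _; rewrite mn1 ltW.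
have /choice[e he] : forall m, exists e : R, 0 < e /\
    forall k, e * (2 / d m) ^+ k.+1 <= (log_weight k)%:R ^+ k.
  move=> m; have [|e e0 he] := @log_weight_absorbs R (2 / d m); last by exists e.
  by rewrite ler_pdivlMr// mul1r (le_trans (dh m))//; lra.
have e0 m : 0 < e m by have [] := he m.
(* The first entry makes the radii of level at least m sum to at most d_m / 8, since 2^-(m+4) =
   2^-(m+1) / 8; the second bounds the moments by the weights. *)
pose eps m := Num.min (d m * 2^-1 ^+ m.+4) (e m * 2^-1 ^+ m.+1).
have eps0 m : 0 < eps m.
  have p0 k : 0 < 2^-1 ^+ k :> R by rewrite exprn_gt0.
  by rewrite lt_min (mulr_gt0 (d0 m) (p0 _)) (mulr_gt0 (e0 m) (p0 _)).
have /choice[cr hcr] : forall m, exists cr : (nat -> R[i]) * (nat -> R) * (R[i] -> R[i]),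
   [/\ forall l, 0 < cr.1.2 l <= eps m / (l.+1%:R * l.+2%:R),
      forall l, cnorm (cr.1.1 l - a m) <= s m &
      let Z := [set z | forall l, cr.1.2 l <= cnorm (z - cr.1.1 l)] in
      [/\ forall z, Z z -> s m <= cnorm (z - a m) -> cr.2 z = 0,
          forall z, Z z -> cnorm (z - a m) <= s m / 2 -> cr.2 z != 0 &
          forall d : R, 0 < d -> exists p q, forall z, Z z ->
            q.[z] != 0 /\ cnorm (cr.2 z - p.[z] / q.[z]) < d]].
  move=> m; have [c [r [G h]]] := mckissick (a m) (s0 m) (eps0 m).
  by exists (c, r, G).
have [f [finj fsurj]] := nat_pair_bijection.
pose c n := (cr (f n).1).1.1 (f n).2.
pose r n := (cr (f n).1).1.2 (f n).2.
pose lev n := (f n).1.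
have r0 n : 0 < r n by rewrite /r; have [/(_ (f n).2)/andP[]] := hcr (f n).1.
have r_le n : r n <= eps (lev n) / ((f n).2.+1%:R * (f n).2.+2%:R).
  by rewrite /r; have [/(_ (f n).2)/andP[]] := hcr (f n).1.
have psi1 l : 0 < (l.+1%:R * l.+2%:R)^-1 :> R by rewrite invr_gt0 mulr_gt0 ?ltr0n.
have psi_le1 l : (l.+1%:R * l.+2%:R)^-1 <= 1 :> R.
  by rewrite invf_le1 ?mulr_gt0 ?ltr0n// mulr_ege1// ler1n.
have eps_d m : eps m <= d m.
  rewrite ge_min; apply/orP; left; rewrite ler_piMr ?(ltW (d0 m))//.
  by rewrite exprn_ile1//; lra.
have sum_map (w : nat -> R) (t : seq nat) (D : R) : 0 <= D -> uniq t ->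
    (forall n, n \in t -> w n <= D * 2^-1 ^+ (lev n).+1 *
      ((f n).2.+1%:R * (f n).2.+2%:R)^-1) -> \sum_(n <- t) w n <= D.
  move=> D0 ut hw.
  have [g fg] : exists g, cancel f g.
    by have /choice[g hg] := fsurj; exists g => n; apply: finj; rewrite hg.
  have -> : \sum_(n <- t) w n = \sum_(x <- map f t) w (g x).
    by rewrite big_map; apply: eq_bigr => n _; rewrite fg.
  apply: pair_sum_le => //; first by rewrite map_inj_uniq.
  by move=> _ /mapP[n nt ->]; rewrite fg; apply: hw.
exists c, r, lev, d; split=> //; split.
- move=> n z Iz; have [_ /(_ (f n).2) hc _] := hcr (f n).1.
  rewrite -/(c n) -/(lev n) in hc; have hI := aI (lev n) z Iz.
  have := cnorm_tri z (a (lev n)) (c n).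
  have hd := ds (lev n).
  have : r n <= d (lev n).
    apply: (le_trans (r_le n)); apply: le_trans (eps_d (lev n)).
    by rewrite ler_piMr// ltW.
  lra.
- move=> t m ut ht; apply: sum_map => //; first by rewrite divr_ge0// ltW.
  move=> n nt; apply: (le_trans (r_le n)); rewrite ler_pM2r//.
  apply: (@le_trans _ _ (d (lev n) * 2^-1 ^+ (lev n).+4)); first by rewrite ge_min lexx.
  have -> : d m / 8 * 2^-1 ^+ (lev n).+1 = d m * 2^-1 ^+ (lev n).+4 by rewrite !exprS; field.
  by rewrite ler_wpM2r ?exprn_ge0// d_decr// ht.
- move=> t k ut; apply: sum_map => //.
  move=> n nt; have A0 : 0 <= (2 / d (lev n)) ^+ k.+1 by rewrite exprn_ge0// divr_ge0// ltW.
  apply: (le_trans (ler_wpM2r A0 (r_le n))).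
  rewrite mulrAC ler_pM2r//.
  apply: (@le_trans _ _ (e (lev n) * 2^-1 ^+ (lev n).+1 * (2 / d (lev n)) ^+ k.+1)).
    by rewrite ler_wpM2r// ge_min lexx orbT.
  rewrite mulrAC ler_wpM2r ?exprn_ge0//.
  by have [] := he (lev n).
move=> x y xI yx.
(* With |x - a| <= s / 2 and s < |y - x| / 2, the point y is at distance more than s from a: the
   function is nonzero at x and vanishes near y. *)
have [|m [xa sm]] := agrid x (cnorm (y - x) / 2) xI.
  by rewrite divr_gt0// cnorm_gt0 subr_eq0.
have [_ _ [G0 G1 GA]] := hcr m.
have ZZ z : (forall n, r n <= cnorm (z - c n)) -> forall l, (cr m).1.2 l <= cnorm (z - (cr m).1.1
  l).
  move=> h l; have [n fn] := fsurj (m, l).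
  by have := h n; rewrite /r /c fn.
exists (cr m).2, (a m), (s m); split=> //.
- have := cnorm_tri y x (a m); rewrite (cnorm_dist (a m)).
  have := s0 m; lra.
- by move=> z /ZZ; apply: G0.
- by move=> z /ZZ; apply: G1.
- by move=> u /GA[p [q pq]]; exists p, q => z /ZZ; apply: pq.
Qed.

End DiscFamily.

Lemma factorial_le_expn n : (n`! <= n ^ n)%N.
Proof.
elim: n => [//|n IH]; rewrite factS expnS leq_mul2l (leq_trans IH)//.
by case: n {IH} => // n; rewrite leq_exp2r.
Qed.

(** * Divergence of the Denjoy-Carleman series *)

Section SeriesDivergence.
Context {R : realType}.

(** The inverse of 0 in [\bar R] is +oo, in agreement with the convention for the series; x = 0 is
    then immediate. *)
Lemma inve_poweR_ge (x : \bar R) (b : R) k : (0 <= x)%E -> (x <= b%:E)%E ->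
  (0 < k)%N -> 0 < b ->
  ((b `^ k%:R^-1)^-1%:E <= (poweR x k%:R^-1)^-1)%E.
Proof.
case: x => [y|//|//]; rewrite !lee_fin => y0 yb k0 b0.
have k1 : k%:R^-1 != 0 :> R by rewrite invr_eq0 pnatr_eq0 -lt0n.
rewrite poweR_EFin inver; case: eqP => [_|h]; first by rewrite leey.
have [y00|y00] := eqVneq y 0; first by case: h; rewrite y00 powR0.
have yp : 0 < y by rewrite lt_def y00.
rewrite lee_fin lef_pV2 ?posrE ?powR_gt0//.
by apply: ge0_ler_powR => //; rewrite ?invr_ge0 ?nnegrE// ltW.
Qed.

(** From k! <= k^k, 4^(k+1) + L^k <= 5 (4 L)^k and 5 K <= B^k one gets u_k <= (4 B k L)^k for k >=
    1, so the k-th term is at least 1 / (4 B k L). *)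
Lemma denjoy_carleman_dvg (u : nat -> \bar R) (K : R) : 0 < K ->
  (forall k, (0 <= u k)%E) ->
  (forall k, (u k <= (k`!%:R * (K * (4 ^+ k.+1 + (log_weight k)%:R ^+ k)))%:E)%E) ->
  (\sum_(1 <= k <oo) (poweR (u k) (k%:R^-1))^-1 = +oo)%E.
Proof.
move=> K0 u0 uK; pose B := 5 * K + 1; have B1 : 1 <= B by rewrite /B; lra.
have term k : (0 < k)%N ->
    (((4 * B)^-1 * (k%:R * (log_weight k)%:R)^-1)%:E <= (poweR (u k) k%:R^-1)^-1)%E.
  move=> k0; set L := (log_weight k)%:R : R.
  have L1 : 1 <= L by rewrite ler1n.
  have kk1 : 1 <= k%:R :> R by rewrite ler1n.
  pose Y := 4 * B * (k%:R * L); have Y0 : 0 < Y by rewrite /Y !mulr_gt0//; lra.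
  have ub : (u k <= (Y ^+ k)%:E)%E.
    apply: (le_trans (uK k)); rewrite lee_fin.
    have f1 : k`!%:R <= k%:R ^+ k :> R.
      by rewrite -natrX ler_nat factorial_le_expn.
    have f2 : 4 ^+ k.+1 + L ^+ k <= 5 * (4 ^+ k * L ^+ k).
      have a1 : 1 <= 4 ^+ k :> R by apply: exprn_ege1; rewrite ler1n.
      have a2 : 1 <= L ^+ k by apply: exprn_ege1.
      have a3 : 4 ^+ k * 1 <= 4 ^+ k * L ^+ k by rewrite ler_wpM2l//; lra.
      have a4 : 1 * L ^+ k <= 4 ^+ k * L ^+ k by rewrite ler_wpM2r//; lra.
      rewrite exprS; lra.
    have f3 : 5 * K <= B ^+ k.
      apply: (@le_trans _ _ B); first by rewrite /B; lra.
      by rewrite -[X in X <= _]expr1; apply: ler_weXn2l.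
    have -> : Y ^+ k = k%:R ^+ k * (B ^+ k * (4 ^+ k * L ^+ k)).
      by rewrite /Y !exprMn; ring.
    have L0 : 0 <= L by lra.
    apply: ler_pM => //.
      by rewrite mulr_ge0 ?(ltW K0)// addr_ge0// exprn_ge0.
    apply: (@le_trans _ _ (K * (5 * (4 ^+ k * L ^+ k)))); first by rewrite ler_pM2l.
    by rewrite mulrA [K * 5]mulrC ler_wpM2r// mulr_ge0 ?exprn_ge0.
  have := inve_poweR_ge (u0 k) ub k0 (exprn_gt0 _ Y0).
  rewrite -powR_mulrn ?(ltW Y0)// -powRrM divff ?pnatr_eq0 -?lt0n// powRr1 ?(ltW Y0)//.
  by rewrite /Y invfM.
have t0 k : (0 <= (poweR (u k) k%:R^-1)^-1)%E by rewrite inve_ge0 poweR_ge0.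
apply/eqyP => A A0; have [n hn] := @log_weight_dvg R (4 * B * A).
have hs := @nneseries_lim_ge R (fun k => (poweR (u k) k%:R^-1)^-1)%E xpredT 1 n.
apply: le_trans (hs _) => //.
apply: (@le_trans _ _ (\sum_(1 <= k < n) ((4 * B)^-1 * (k%:R * (log_weight k)%:R)^-1)%:E)%E).
  rewrite sumEFin lee_fin -mulr_sumr mulrC ler_pdivlMr; last by lra.
  by rewrite mulrC.
rewrite big_seq [X in (_ <= X)%E]big_seq; apply: lee_sum => k.
by rewrite mem_index_iota => /andP[k0 _]; apply: term.
Qed.

End SeriesDivergence.

Theorem theorem5 (R : realType) :
  exists X : set R[i],
    [/\ swiss_cheese X,
        half_segment `<=` X,
        forall z, (X `\` half_segment) z ->
          continuity_point X (rational_algebra X) z &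
        forall f, rational_algebra X f ->
          smooth_within half_segment f /\
          (\sum_(1 <= k <oo)
             (poweR (sup_norm half_segment (nderive_within half_segment k f))
                    (k%:R^-1))^-1 = +oo)%E].
Proof.
have [c [r [lev [d [r0 d0 d00 d_decr [far r_sum r_moment sep]]]]]] := @disc_family R.
pose X : set R[i] := [set z | `|z| <= 1] `\` \bigcup_n ball (c n) (r n)%:C.
have XP z : X z <-> cnorm z <= 1 /\ forall n, r n <= cnorm (z - c n).
  split=> [[/= z1 zn]|[z1 zn]].
    split; first by rewrite -lecR -cnormE.
    move=> n; rewrite leNgt; apply/negP => h; apply: zn; exists n => //.
    by apply/ball_cnorm; rewrite cnorm_dist.
  split; first by rewrite /= cnormE lecR.
  by move=> [n _ /ball_cnorm]; rewrite cnorm_dist ltNge zn.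
have cX : compact X.
  have -> : X = [set z | cnorm z <= 1] `&`
      ~` (\bigcup_n [set z | cnorm (z - c n) < r n]).
    apply/seteqP; split=> z.
      by move=> /XP[z1 zn]; split=> //= -[n _ /=]; rewrite ltNge zn.
    move=> [/= z1 zn]; apply/XP; split=> // n; rewrite leNgt; apply/negP => h.
    by apply: zn; exists n.
  apply: compact_closedI; first exact: compact_unit_disc.
  by apply: open_closedC; apply: bigcup_open => n _; apply: open_cnorm_lt.
have IX : half_segment `<=` X.
  move=> z Iz; apply/XP; split; first by have := half_segment_le Iz; lra.
  by move=> n; have := far n z Iz; have := d0 (lev n); lra.
exists X; split=> //.
- split=> //; exists c, r; split=> //.
  apply: nondecreasing_is_cvgn.
    by apply: nondecreasing_series => n *; apply/ltW/r0.
  exists (d 0%N / 8) => _ [n _ <-]; rewrite /series /= /index_iota subn0.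
  by apply: r_sum; rewrite ?iota_uniq.
- move=> x [Xx xI]; split=> // -[y [Xy yx hy]].
  have [G [a [s [xa ya G0 G1 GA]]]] := sep x y xI yx.
  have XZ z : X z -> forall n, r n <= cnorm (z - c n) by move=> /XP[].
  have GA' (e : R) : 0 < e -> exists p q, forall z, X z ->
      q.[z] != 0 /\ cnorm (G z - p.[z] / q.[z]) < e.
    by move=> /GA[p [q pq]]; exists p, q => z /XZ; apply: pq.
  (* G belongs to the ideal of functions vanishing near y but not to that of x. *)
  have [|_ Gx] := hy G; last by have := G1 x (XZ x Xx) xa; rewrite Gx eqxx.
  split; first by split; [exact: closure_rational_continuous|exact/closure_rational_onP].
  apply/nbhs_cnormP; exists (cnorm (y - a) - s); first by rewrite subr_gt0.
  move=> w yw Xw; apply: G0; first exact: XZ.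
  by have := cnorm_tri y a w; lra.
move=> f [_ /closure_rational_onP happ].
have [|B B0 fB] := closure_rational_bounded cX _ happ; first by move=> z /XP[].
have hX := cauchy_system_discs r0 d0 d00 d_decr half_segment0 half_segment_le far r_sum r_moment.
have [F [F0 Fle Fdiff]] := closure_rational_taylor IX hX B0 happ fB.
have Fd k z z' : half_segment z -> half_segment z' ->
    cnorm (F k z' - F k z - k.+1%:R * (z' - z) * F k.+1 z) <=
    ((k.+1 ^ 2)%:R * ((B + 1) * (4 ^+ k.+3 + (log_weight k.+2)%:R ^+ k.+2))) *
      cnorm (z' - z) ^+ 2.
  by move=> Iz Iz'; apply: le_trans (Fdiff k z z' Iz Iz') _; rewrite le_eqVlt; apply/orP;
    left; apply/eqP; ring.
split; first exact: (smooth_within_taylor half_segment_perfect F0 Fd).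
have B10 : 0 < B + 1 by lra.
apply: (denjoy_carleman_dvg B10) => k.
  apply: le_ereal_sup_tmp; exists (cnorm (nderive_within half_segment k f 0))%:E.
    by exists 0 => //; apply: half_segment0.
  by rewrite lee_fin cnorm_ge0.
apply: ge_ereal_sup => _ [z Iz <-]; rewrite lee_fin.
rewrite (nderive_withinE half_segment_perfect F0 Fd)// -/(cnorm _) cnormM cnorm_nat.
by rewrite ler_wpM2l// Fle.
Qed.
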